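(* Let $X$ be a Banach space, $T:L_1(X)\to L_1(X)$ be a bounded linear operator, and let $A$, $B$ be bounded subsets of $X^*$ and $X$, respectively. Assume that $B$ contains no sequence that is equivalent to the unit vector basis of $\ell_1$. Then, for every $f\in L_1$, the set $$\big\{T^{(x^*,x)}f: (x^*,x)\in A\times B\big\}$$ is a uniformly integrable (and thus weakly relatively compact) subset of $L_1$. In particular, every sequence in $\{T^{(x^*,x)}:(x^*,x)\in A\times B\}$ has a subsequence that converges in the weak operator topology of the bounded operators on $L_1$.
   Context: $L_1=L_1[0,1)$ with Lebesgue measure, and $L_1(X)$ is the Bochner space of $X$-valued integrable functions on $[0,1)$. For $f\in L_1$, $x\in X$, $(f\otimes x)(s)=f(s)x$. For $g\in L_\infty$, $x^*\in X^*$, $u\in L_1(X)$, $\langle g\otimes x^*,u\rangle=\int_0^1 g(s)\,x^*(u(s))\,ds$. For $x^*\in X^*$ and $x\in X$, $T^{(x^*,x)}:L_1\to L_1$ is the unique bounded linear operator with $\langle g,T^{(x^*,x)}f\rangle=\langle g\otimes x^*,T(f\otimes x)\rangle$ for all $g\in L_\infty$, $f\in L_1$. *)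

(* Defs.v *)
From HB Require Import structures.
From mathcomp Require Import all_boot all_order all_algebra.
From mathcomp Require Import generic_quotient ring_quotient.
From mathcomp Require Import all_classical all_reals all_analysis.
From mathcomp Require Import measurable_realfun ess_sup_inf.
Set Implicit Arguments.
Unset Strict Implicit.
Unset Printing Implicit Defensive.
Import Order.TTheory GRing.Theory Num.Theory.
Import numFieldNormedType.Exports.
Local Open Scope classical_set_scope.
Local Open Scope ring_scope.

Section bounded_operators.
Context (R : realType).

(* Bounded, i.e. continuous, linear operators between normed spaces. *)
Record bop (V W : normedModType R) := Bop {
  bop_fun :> {linear V -> W};
  bop_continuous : continuous bop_fun }.

Definition dual (V : normedModType R) := bop V R^o.

Lemma bop_ext (V W : normedModType R) (S S' : bop V W) :
  (forall v, S v = S' v) -> S = S'.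
Proof.
case: S S' => [f cf] [g cg] /= fg.
have E : f = g.
  case: f g fg {cf cg} => [f cf] [g cg] /= /funext E.
  move: cf cg; rewrite E => -[[a] [b]] [[a'] [b']].
  by rewrite (Prop_irrelevance a a') (Prop_irrelevance b b').
by move: cf cg; rewrite E => cf cg; rewrite (Prop_irrelevance cf cg).
Qed.

HB.instance Definition _ (V W : normedModType R) := gen_eqMixin (bop V W).
HB.instance Definition _ (V W : normedModType R) := gen_choiceMixin (bop V W).

Definition opnorm (V W : normedModType R) (S : bop V W) : R :=
  sup [set `|S v| | v in [set v : V | `|v| <= 1]].

Definition bounded_dual_set (V : normedModType R) (A : set (dual V)) :=
  exists M : R, forall phi, A phi -> opnorm phi <= M.

(* V with its weak topology: the coarsest one making all phi in V^* continuous. *)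
Definition weak (V : normedModType R) : Type :=
  sup_topology (fun phi : dual V =>
    Topological.class (initial_topology (phi : V -> R^o))).

HB.instance Definition _ (V : normedModType R) := Topological.on (weak V).

(* The weak operator topology: the coarsest one making S |-> psi (S v) continuous
   for all psi in W^* and v in V. *)
Definition wot (V W : normedModType R) : Type :=
  sup_topology (fun p : dual W * V =>
    Topological.class (initial_topology (fun S : bop V W => p.1 (S p.2) : R^o))).

HB.instance Definition _ (V W : normedModType R) := Topological.on (wot V W).

Lemma cvg_initial (S : choiceType) (U : topologicalType) (f : S -> U)
    (F : set_system S) (s : S) : Filter F ->
  F --> (s : initial_topology f) <-> f @ F --> f s.
Proof.
move=> FF; split => [Fs|fFs].
  by apply: (cvg_comp _ _ Fs); exact: (@initial_continuous S U f s).
move=> A [_ [[B oB <-] Bs sBA]]; apply: (filterS sBA).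
by apply: fFs; exact: open_nbhs_nbhs.
Qed.

Lemma cvg_weakP (V : normedModType R) (F : set_system V) (v : V) : Filter F ->
  F --> (v : weak V) <-> forall phi : dual V, phi @ F --> phi v.
Proof.
move=> FF; split => [/cvg_sup H phi|H].
  exact/(cvg_initial (phi : V -> R^o))/H.
by apply/cvg_sup => phi; apply/(cvg_initial (phi : V -> R^o)); exact: H.
Qed.

Lemma cvg_wotP (V W : normedModType R) (F : set_system (bop V W)) (S : bop V W) :
  Filter F -> F --> (S : wot V W) <->
  forall (psi : dual W) (v : V), (fun S' : bop V W => psi (S' v)) @ F --> psi (S v).
Proof.
move=> FF; split => [/cvg_sup H psi v|H].
  exact/(cvg_initial (fun S' : bop V W => psi (S' v) : R^o))/(H (psi, v)).
apply/cvg_sup => -[psi v].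
by apply/(cvg_initial (fun S' : bop V W => psi (S' v) : R^o)); exact: H.
Qed.

(* (x_n) is equivalent to the unit vector basis of ell_1. *)
Definition equiv_ell1 (V : normedModType R) (x : nat -> V) :=
  exists c C : R, [/\ 0 < c, 0 < C &
    forall (n : nat) (a : nat -> R),
      c * (\sum_(i < n) `|a i|) <= `|\sum_(i < n) a i *: x i| /\
      `|\sum_(i < n) a i *: x i| <= C * \sum_(i < n) `|a i| ].

End bounded_operators.

Section strong_measurability.
Context d (T : measurableType d) (R : realType).

Definition simple_map (V : Type) (s : T -> V) :=
  finite_set (range s) /\ forall v, measurable (s @^-1` [set v]).

(* Convergence everywhere, rather than almost everywhere, is no restriction for
   L_1(V): every class modulo null sets has such a representative. *)
Definition strongly_measurable (V : normedModType R) (f : T -> V) :=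
  exists2 s : nat -> T -> V, (forall n, simple_map (s n)) &
    forall t, s n t @[n --> \oo] --> f t.

Lemma simple_map_preimage (V : Type) (s : T -> V) (A : set V) :
  simple_map s -> measurable (s @^-1` A).
Proof.
move=> [fs ms].
rewrite (_ : s @^-1` A = \bigcup_(v in range s `&` A) s @^-1` [set v]).
  by apply: fin_bigcup_measurable => //; exact: finite_setIl.
apply/seteqP; split => t /=; first by move=> At; exists (s t) => //; split.
by move=> [v [_ Av]] /= ->.
Qed.

Lemma simple_map2 (U V W : Type) (h : U -> V -> W) (s : T -> U) (r : T -> V) :
  simple_map s -> simple_map r -> simple_map (fun t => h (s t) (r t)).
Proof.
move=> fs fr; split.
  apply: (@sub_finite_set _ _ [set h u v | u in range s & v in range r]).
    by move=> _ [t _ <-]; exists (s t) => //; exists (r t).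
  by apply: finite_image2; [case: fs|case: fr].
move=> w.
rewrite (_ : _ @^-1` _ = \bigcup_(u in range s)
    (s @^-1` [set u] `&` r @^-1` [set v | h u v = w])).
  apply: fin_bigcup_measurable; first by case: fs.
  by move=> u _; apply: measurableI; exact: simple_map_preimage.
apply/seteqP; split => t /=; first by move=> E; exists (s t).
by move=> [u _] [/= -> ->].
Qed.

Lemma strongly_measurable2 (U V W : normedModType R) (h : U -> V -> W)
    (f : T -> U) (g : T -> V) : continuous (fun p : U * V => h p.1 p.2) ->
  strongly_measurable f -> strongly_measurable g ->
  strongly_measurable (fun t => h (f t) (g t)).
Proof.
move=> ch [s ss sf] [r sr rg]; exists (fun n t => h (s n t) (r n t)).
  by move=> n; exact: simple_map2.
by move=> t; apply: (continuous2_cvg _ (ch (f t, g t)) (sf t) (rg t)).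
Qed.

Lemma strongly_measurable_cst (V : normedModType R) (v : V) :
  strongly_measurable (fun _ : T => v).
Proof.
exists (fun _ _ => v); last by move=> t; exact: cvg_cst.
move=> n; split; last by move=> w; rewrite preimage_cst; case: ifP.
by apply: (@sub_finite_set _ _ [set v]) => // _ [t _ <-].
Qed.

Lemma strongly_measurable1 (V W : normedModType R) (h : V -> W) (f : T -> V) :
  continuous h -> strongly_measurable f -> strongly_measurable (h \o f).
Proof.
move=> ch mf.
apply: (@strongly_measurable2 V V W (fun v _ => h v)) (mf) => //.
by move=> p; apply: (continuous_comp _ (ch _)); exact: cvg_fst.
Qed.

Lemma strongly_measurable_fun (f : T -> R^o) :
  strongly_measurable f -> measurable_fun setT (f : T -> R).
Proof.
move=> [s ss sf].
apply: (@measurable_fun_cvg _ _ _ setT (s : nat -> T -> R)) => //.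
by move=> n _ A mA; rewrite setTI; exact: simple_map_preimage.
Qed.

Lemma strongly_measurable_norm (V : normedModType R) (f : T -> V) :
  strongly_measurable f -> measurable_fun setT (fun t => `|f t|).
Proof.
move=> mf; apply: strongly_measurable_fun.
exact: (@strongly_measurable1 V R^o _ _ (@norm_continuous _ V) mf).
Qed.

End strong_measurability.
Section L1_space.
Context d (T : measurableType d) (R : realType).
Variables (mu : {measure set T -> \bar R}) (V : normedModType R).

Definition bochner_integrable (f : T -> V) :=
  strongly_measurable f /\ (\int[mu]_t (`|f t|)%:E < +oo)%E.

Definition bochner : {pred T -> V} := mem [set f | bochner_integrable f].

Lemma bochnerP f : reflect (bochner_integrable f) (f \in bochner).
Proof. by apply: (iffP idP) => [/set_mem//|?]; exact: mem_set. Qed.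

Lemma bochner_submod_closed : submod_closed bochner.
Proof.
split.
  apply/bochnerP; split; first exact: strongly_measurable_cst.
  by under eq_integral do rewrite normr0; rewrite integral0.
move=> a f g /bochnerP[mf lf] /bochnerP[mg lg]; apply/bochnerP.
have maf : strongly_measurable (fun t => a *: f t).
  exact: (@strongly_measurable1 _ _ _ _ _ ( *:%R a) f (@scaler_continuous _ _ _) mf).
have mafg : strongly_measurable (fun t => a *: f t + g t).
  exact: (@strongly_measurable2 _ _ _ _ _ _ +%R _ g (@add_continuous V) maf mg).
split => //.
apply: (@le_lt_trans _ _ (\int[mu]_t (`|a *: f t|%:E + `|g t|%:E))%E).
  apply: ge0_le_integral => //.
  - exact/measurable_EFinP/strongly_measurable_norm.
  - by apply: emeasurable_funD; exact/measurable_EFinP/strongly_measurable_norm.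
  - by move=> t _; rewrite -EFinD lee_fin ler_normD.
rewrite ge0_integralD//; try exact/measurable_EFinP/strongly_measurable_norm.
rewrite lte_add_pinfty//.
under eq_integral do rewrite normrZ EFinM.
rewrite ge0_integralZl//; last exact/measurable_EFinP/strongly_measurable_norm.
by rewrite lte_mul_pinfty// lee_fin.
Qed.

HB.instance Definition _ :=
  GRing.isSubmodClosed.Build R (T -> V) bochner bochner_submod_closed.

Record L1fun := L1Fun { L1fun_val :> T -> V; L1funP : L1fun_val \in bochner }.
HB.instance Definition _ := [isSub for L1fun_val].
HB.instance Definition _ := [Choice of L1fun by <:].
HB.instance Definition _ := [SubChoice_isSubLmodule of L1fun by <:].

Lemma L1fun_strong (f : L1fun) : strongly_measurable f.
Proof. by case: (bochnerP f (L1funP f)). Qed.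

Lemma L1fun_norm_measurable (f : L1fun) :
  measurable_fun setT (fun t => `|f t|%:E).
Proof. exact/measurable_EFinP/strongly_measurable_norm/L1fun_strong. Qed.
Local Hint Resolve L1fun_norm_measurable : core.

Lemma L1fun_fin (f : L1fun) : (\int[mu]_t (`|f t|)%:E)%E \is a fin_num.
Proof.
rewrite ge0_fin_numE ?integral_ge0//.
by case: (bochnerP f (L1funP f)).
Qed.

Definition nullfun : {pred L1fun} :=
  mem [set f : L1fun | {ae mu, forall t, f t = 0}].

Lemma nullfunP (f : L1fun) :
  reflect ({ae mu, forall t, f t = 0}) (f \in nullfun).
Proof. by apply: (iffP idP) => [/set_mem//|?]; exact: mem_set. Qed.

Lemma nullfun_zmod_closed : zmod_closed nullfun.
Proof.
split; first by apply/nullfunP; exact: nearW.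
move=> f g /nullfunP f0 /nullfunP g0; apply/nullfunP.
apply: filterS2 f0 g0 => t /= ft gt.
by rewrite -[LHS]/(f t - g t) ft gt subr0.
Qed.

HB.instance Definition _ :=
  GRing.isZmodClosed.Build L1fun nullfun nullfun_zmod_closed.

(* The Bochner space L_1(mu; V): the Bochner integrable functions modulo
   equality mu-almost everywhere. *)
Definition L1 : Type := Quotient.quot nullfun.
HB.instance Definition _ := Choice.on L1.
HB.instance Definition _ := GRing.Zmodule.on L1.
HB.instance Definition _ := EqQuotient.on L1.

Definition L1_class (f : L1fun) : L1 := (\pi_L1 f)%qT.
Definition L1_repr (u : L1) : L1fun := repr u.
Coercion L1_repr : L1 >-> L1fun.

Lemma L1_reprK (u : L1) : L1_class u = u. Proof. exact: reprK. Qed.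

Lemma L1_class_eq (f g : L1fun) :
  L1_class f = L1_class g <-> {ae mu, forall t, f t = g t}.
Proof.
transitivity (f - g \in nullfun).
  by rewrite Quotient.idealrBE; split => [/eqP|/eqP].
split => [/nullfunP|] fg; last apply/nullfunP.
  by apply: filterS fg => t /= /eqP; rewrite subr_eq0 => /eqP.
by apply: filterS fg => t /= E; rewrite -[LHS]/(f t - g t) E subrr.
Qed.

Lemma L1_eq (u v : L1) : u = v <-> {ae mu, forall t, u t = v t}.
Proof. by rewrite -L1_class_eq !L1_reprK. Qed.

Lemma L1_classE (f : L1fun) : {ae mu, forall t, L1_class f t = f t}.
Proof. by apply/L1_class_eq; rewrite L1_reprK. Qed.

Lemma L1_classD (f g : L1fun) : L1_class (f + g) = L1_class f + L1_class g.
Proof. exact: Quotient.pi_add. Qed.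

Definition L1_scale (a : R) (u : L1) : L1 := L1_class (a *: (u : L1fun)).

Lemma L1_classZ (a : R) (f : L1fun) : L1_scale a (L1_class f) = L1_class (a *: f).
Proof.
apply/L1_class_eq; apply: filterS (L1_classE f) => t /= E.
by rewrite -[LHS]/(a *: (L1_class f t)) E.
Qed.

Let scaleA a b u : L1_scale a (L1_scale b u) = L1_scale (a * b) u.
Proof. by rewrite -(L1_reprK u) !L1_classZ scalerA. Qed.
Let scale1 : left_id 1 L1_scale.
Proof. by move=> u; rewrite -[in LHS](L1_reprK u) L1_classZ scale1r L1_reprK. Qed.
Let scaleDr : right_distributive L1_scale +%R.
Proof.
move=> a u v; rewrite -(L1_reprK u) -(L1_reprK v) -L1_classD !L1_classZ.
by rewrite scalerDr L1_classD.
Qed.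
Let scaleDl u : {morph L1_scale^~ u : a b / a + b}.
Proof. by move=> a b; rewrite -(L1_reprK u) !L1_classZ scalerDl L1_classD. Qed.

HB.instance Definition _ :=
  GRing.Zmodule_isLmodule.Build R L1 scaleA scale1 scaleDr scaleDl.

Lemma L1_reprD (u v : L1) : {ae mu, forall t, (u + v : L1) t = u t + v t}.
Proof.
apply: (proj1 (@L1_class_eq (u + v : L1) (L1_repr u + L1_repr v))).
by rewrite L1_classD !L1_reprK.
Qed.

Lemma L1_reprZ (a : R) (u : L1) : {ae mu, forall t, (a *: u : L1) t = a *: u t}.
Proof. exact: L1_classE. Qed.

Lemma L1_repr0 : {ae mu, forall t, (0 : L1) t = 0}.
Proof.
apply: (proj1 (@L1_class_eq (0 : L1) 0)); rewrite L1_reprK.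
rewrite -[in RHS](scale0r (0 : L1fun)) -L1_classZ.
exact/esym/(scale0r (L1_class 0)).
Qed.

Definition L1_norm (u : L1) : R := fine (\int[mu]_t (`|u t|)%:E)%E.

Lemma L1_normE (u : L1) : (L1_norm u)%:E = (\int[mu]_t (`|u t|)%:E)%E.
Proof. by rewrite fineK// L1fun_fin. Qed.

Let normD (u v : L1) : L1_norm (u + v) <= L1_norm u + L1_norm v.
Proof.
rewrite -lee_fin EFinD !L1_normE -ge0_integralD//.
apply: ae_ge0_le_integral => //.
- by move=> t _; rewrite adde_ge0.
- exact: emeasurable_funD.
by apply: filterS (L1_reprD u v) => t /= -> _; rewrite -EFinD lee_fin ler_normD.
Qed.

Let normZ (a : R) (u : L1) : L1_norm (a *: u) = `|a| * L1_norm u.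
Proof.
apply: EFin_inj; rewrite EFinM !L1_normE -ge0_integralZl//; last first.
apply: ge0_ae_eq_integral => //.
- by apply: measurable_funeM.
by apply: filterS (L1_reprZ a u) => t /= -> _; rewrite normrZ.
Qed.

Let norm_eq0 (u : L1) : L1_norm u = 0 -> u = 0.
Proof.
move=> nu0; have := L1_normE u; rewrite nu0 => u0; apply/L1_eq.
have H : ae_eq mu setT (fun t => `|u t|%:E) (cst 0%E).
  apply/ae_eq_integral_abs => //=; rewrite [RHS]u0.
  by apply: eq_integral => t _; rewrite normr_id.
apply: filterS2 H L1_repr0 => t /= + ->.
by move=> /(_ Logic.I) /= [/normr0_eq0].
Qed.

HB.instance Definition _ := Lmodule_isNormed.Build R L1 normD normZ norm_eq0.

End L1_space.
Arguments L1_class {d T R mu V}.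
Arguments bochner {d T R} mu V.

Section linear_maps.
Context (R : realType).

Lemma bop_bound (V W : normedModType R) (S : bop V W) :
  exists2 M : R, 0 <= M & forall v, `|S v| <= M * `|v|.
Proof.
have /linear_boundedP : bounded_near S (nbhs 0).
  exact/linear_bounded_continuous/bop_continuous.
move=> [M [Mr HM]]; exists (`|M| + 1); first by rewrite addr_ge0.
by apply: HM; rewrite (le_lt_trans (ler_norm M))// ltrDl.
Qed.

Lemma linear_bound_continuous (V W : normedModType R) (S : {linear V -> W}) (M : R) :
  (forall v, `|S v| <= M * `|v|) -> continuous S.
Proof.
move=> HM; apply/linear_bounded_continuous/linear_boundedP.
exists M; split; first exact: num_real.
by move=> r Mr v; rewrite (le_trans (HM v))// ler_wpM2r// ltW.
Qed.

Definition bop_of (V W : normedModType R) (f : V -> W) (lf : linear f) (M : R)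
    (HM : forall v, `|f v| <= M * `|v|) : bop V W :=
  let F := GRing.isLinear.Build R V W _ f lf in
  let L : {linear V -> W} := HB.pack f F in
  @Bop R V W L (@linear_bound_continuous V W L M HM).

End linear_maps.

Section components.
Context d (T : measurableType d) (R : realType).
Variables (mu : {measure set T -> \bar R}) (X : normedModType R).

Lemma bochner_tensor (f : L1 mu R^o) (x : X) :
  (fun t => f t *: x) \in bochner mu X.
Proof.
apply/bochnerP; split.
  apply: (@strongly_measurable1 _ _ _ R^o X (fun a => a *: x)).
    exact: scalel_continuous.
  exact: L1fun_strong.
under eq_integral do rewrite normrZ EFinM.
rewrite ge0_integralZr//; last exact: L1fun_norm_measurable.
by rewrite -L1_normE -EFinM ltry.
Qed.

Definition tensor (f : L1 mu R^o) (x : X) : L1 mu X :=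
  L1_class (L1Fun (bochner_tensor f x)).

Lemma bochner_dual (phi : dual X) (u : L1 mu X) :
  (phi \o u : T -> R^o) \in bochner mu R^o.
Proof.
have [M M0 HM] := bop_bound phi.
have m1 : strongly_measurable (phi \o u).
  by apply: strongly_measurable1; [exact: bop_continuous|exact: L1fun_strong].
apply/bochnerP; split => //.
apply: (@le_lt_trans _ _ (\int[mu]_t (M%:E * `|u t|%:E))%E).
  apply: ge0_le_integral => //.
  - by apply/measurable_EFinP; exact: (strongly_measurable_norm m1).
  - by apply: measurable_funeM; exact: L1fun_norm_measurable.
  - by move=> t _; rewrite -EFinM lee_fin; exact: HM.
rewrite ge0_integralZl//; last exact: L1fun_norm_measurable.
by rewrite -L1_normE -EFinM ltry.
Qed.

Definition dual_comp (phi : dual X) (u : L1 mu X) : L1 mu R^o :=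
  L1_class (L1Fun (bochner_dual phi u)).

Lemma L1_class_linear (V W : normedModType R) (F : L1 mu V -> T -> W)
    (bF : forall u, F u \in bochner mu W) (a : R) (u v : L1 mu V) :
  {ae mu, forall t, F (a *: u + v) t = a *: F u t + F v t} ->
  L1_class (L1Fun (bF (a *: u + v))) =
  a *: (L1_class (L1Fun (bF u)) : L1 mu W) + L1_class (L1Fun (bF v)).
Proof.
move=> Fuv.
rewrite [X in _ = X + _](L1_classZ a (L1Fun (bF u))) -L1_classD.
exact/L1_class_eq.
Qed.

Lemma L1_repr_linear (V : normedModType R) (a : R) (u v : L1 mu V) :
  {ae mu, forall t, (a *: u + v : L1 mu V) t = a *: u t + v t}.
Proof.
apply: filterS2 (L1_reprD (a *: u) v) (L1_reprZ a u) => t /= -> E.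
by congr (_ + _).
Qed.

Lemma tensor_linear (x : X) : linear (tensor^~ x).
Proof.
move=> a f g.
apply: (@L1_class_linear R^o X (fun f t => f t *: x) (bochner_tensor^~ x)).
apply: filterS (L1_repr_linear a f g) => t /= ->.
by rewrite scalerDl scalerA.
Qed.

Lemma dual_comp_linear (phi : dual X) : linear (dual_comp phi).
Proof.
move=> a u v.
apply: (@L1_class_linear X R^o (fun u => phi \o u) (bochner_dual phi)).
by apply: filterS (L1_repr_linear a u v) => t /= ->; rewrite linearP.
Qed.

Lemma L1_norm_class (V : normedModType R) (f : L1fun mu V) :
  (`|L1_class f|%:E = \int[mu]_t `|f t|%:E)%E.
Proof.
rewrite -[`|_|]/(L1_norm _) L1_normE.
apply: ge0_ae_eq_integral => //; try exact: L1fun_norm_measurable.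
by apply: filterS (L1_classE f) => t /= ->.
Qed.

Lemma norm_tensor (x : X) (f : L1 mu R^o) : `|tensor f x| <= `|x| * `|f|.
Proof.
rewrite -lee_fin L1_norm_class /=.
under eq_integral do rewrite normrZ EFinM.
rewrite ge0_integralZr//; last exact: L1fun_norm_measurable.
by rewrite -L1_normE -EFinM mulrC.
Qed.

Lemma norm_dual_comp (phi : dual X) (M : R) (u : L1 mu X) : 0 <= M ->
  (forall x, `|phi x| <= M * `|x|) -> `|dual_comp phi u| <= M * `|u|.
Proof.
move=> M0 HM.
rewrite -lee_fin L1_norm_class EFinM -[`|u|]/(L1_norm u) L1_normE.
rewrite -ge0_integralZl//; last exact: L1fun_norm_measurable.
apply: ge0_le_integral => //.
- exact: L1fun_norm_measurable.
- by apply: measurable_funeM; exact: L1fun_norm_measurable.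
- by move=> t _; rewrite -EFinM lee_fin; exact: HM.
Qed.

(* <g, f> and <g (x) phi, u>, for g in L_oo, f in L_1, u in L_1(X), phi in X^*. *)
Definition pairing (g : T -> R) (f : L1 mu R^o) : R :=
  \int[mu]_t (g t * f t).

Definition tensor_pairing (g : T -> R) (phi : dual X) (u : L1 mu X) : R :=
  \int[mu]_t (g t * phi (u t)).

Definition is_component (S : bop (L1 mu X) (L1 mu X)) (phi : dual X) (x : X)
    (C : bop (L1 mu R^o) (L1 mu R^o)) :=
  forall (g : T -> R) (f : L1 mu R^o), g \in Lfun mu +oo%E ->
    pairing g (C f) = tensor_pairing g phi (S (tensor f x)).

Lemma Linfty_measurable (g : T -> R) : g \in Lfun mu +oo%E -> measurable_fun setT g.
Proof. by rewrite inE => /andP[/[!inE]]. Qed.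

Lemma L1_repr_measurable (f : L1 mu R^o) : measurable_fun setT (f : T -> R).
Proof. exact/strongly_measurable_fun/L1fun_strong. Qed.

Lemma dual_repr_measurable (phi : dual X) (u : L1 mu X) :
  measurable_fun setT (fun t => phi (u t) : R).
Proof.
have m1 : strongly_measurable (phi \o u).
  by apply: strongly_measurable1; [exact: bop_continuous|exact: L1fun_strong].
exact: (strongly_measurable_fun m1).
Qed.

Lemma component_exists (S : bop (L1 mu X) (L1 mu X)) (phi : dual X) (x : X) :
  exists C, is_component S phi x C.
Proof.
have [M M0 HM] := bop_bound S.
have [N N0 HN] := bop_bound phi.
have lin : linear (fun f => dual_comp phi (S (tensor f x))).
  by move=> a f g; rewrite tensor_linear linearP dual_comp_linear.
have bnd f : `|dual_comp phi (S (tensor f x))| <= N * M * `|x| * `|f|.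
  rewrite (le_trans (norm_dual_comp _ N0 HN))// -!mulrA ler_wpM2l//.
  by rewrite (le_trans (HM _))// ler_wpM2l// norm_tensor.
exists (bop_of lin bnd) => g f gL /=.
rewrite /pairing /tensor_pairing /Rintegral; congr fine.
apply: ae_eq_integral => //.
- apply/measurable_EFinP/measurable_funM; first exact: Linfty_measurable.
  exact: L1_repr_measurable.
- apply/measurable_EFinP/measurable_funM; first exact: Linfty_measurable.
  exact: dual_repr_measurable.
by apply: filterS (L1_classE (L1Fun (bochner_dual phi (S (tensor f x))))) => t /= ->.
Qed.

Lemma indic_Linfty (E : set T) : measurable E -> \1_E \in Lfun mu +oo%E.
Proof.
move=> mE; rewrite inE; apply/andP; split; first by rewrite inE; exact: measurable_indic.
rewrite inE/= /finite_norm unlock; case: ifPn => // mu0.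
apply: (@le_lt_trans _ _ 1%E); last exact: ltry.
apply/ess_supP/nearW => t /=.
by rewrite lee_fin indicE normr_nat lern1 leq_b1.
Qed.

Lemma L1_integrable (f : L1 mu R^o) : mu.-integrable setT (EFin \o (f : T -> R)).
Proof.
apply/integrableP; split; first exact/measurable_EFinP/L1_repr_measurable.
by have := L1fun_fin f; rewrite ge0_fin_numE ?integral_ge0.
Qed.

Lemma component_unique (S : bop (L1 mu X) (L1 mu X)) (phi : dual X) (x : X)
    (C C' : bop (L1 mu R^o) (L1 mu R^o)) :
  is_component S phi x C -> is_component S phi x C' -> C = C'.
Proof.
move=> HC HC'; apply: bop_ext => f; apply/L1_eq.
have : ae_eq mu setT (EFin \o (C f : L1 mu R^o)) (EFin \o (C' f : L1 mu R^o)).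
  apply: integral_ae_eq => //; first exact: L1_integrable.
    exact/measurable_EFinP/L1_repr_measurable.
  move=> E _ mE.
  have intE (h : L1 mu R^o) : (\int[mu]_(t in E) (h t)%:E)%E = (pairing \1_E h)%:E.
    have hE : (\int[mu]_(t in E) (h t)%:E)%E = (\int[mu]_t (\1_E t * h t)%:E)%E.
      rewrite integral_mkcond; apply: eq_integral => t _.
      by rewrite patchE indicE; case: ifP => _; rewrite ?mul1r ?mul0r.
    rewrite /pairing /Rintegral -hE fineK//.
    apply: integrable_fin_num => //.
    by apply: integrableS (L1_integrable h).
  by rewrite /= !intE (HC _ _ (indic_Linfty mE)) (HC' _ _ (indic_Linfty mE)).
by apply: filterS => t /(_ Logic.I) /= [].
Qed.

(* The operator T^(phi, x); by component_unique the choice is immaterial. *)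
Definition component (S : bop (L1 mu X) (L1 mu X)) (phi : dual X) (x : X) :
  bop (L1 mu R^o) (L1 mu R^o) := projT1 (cid (component_exists S phi x)).

Lemma componentP (S : bop (L1 mu X) (L1 mu X)) (phi : dual X) (x : X) :
  is_component S phi x (component S phi x).
Proof. exact: (projT2 (cid (component_exists S phi x))). Qed.

Definition uniformly_integrable (K : set (L1 mu R^o)) :=
  bounded_set K /\
  forall e : R, 0 < e -> exists2 del : R, 0 < del &
    forall (f : L1 mu R^o) (E : set T), K f -> measurable E ->
      (mu E < del%:E)%E -> \int[mu]_(t in E) `|f t| < e.

End components.

Section unit_interval.
Context (R : realType).

(* Lebesgue measure on [0, 1), as a measure on the real line that vanishes off
   [0, 1): L1 (lebesgue01 R) X is L_1(X), with representatives defined on the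
   whole line but identified when they agree almost everywhere on [0, 1). *)
Definition lebesgue01 : {measure set (measurableTypeR R) -> \bar R} :=
  mrestr (@lebesgue_measure R) (measurable_itv `[0%R, 1%R[).

End unit_interval.

(* Main.v *)
Require Import Defs.
From HB Require Import structures.
From mathcomp Require Import finmap.
From mathcomp Require Import all_boot all_order all_algebra.
From mathcomp Require Import all_classical all_reals all_analysis.
From mathcomp Require Import measurable_realfun ring lra.
Set Implicit Arguments.
Unset Strict Implicit.
Unset Printing Implicit Defensive.
Import Order.TTheory GRing.Theory Num.Theory.
Import numFieldNormedType.Exports.
Import HBSimple.
Local Open Scope classical_set_scope.
Local Open Scope ring_scope.

(** Why the theorem holds.

    For fixed f, the map x |-> T(f (x) x) is a bounded operator u from X to
    L_1(X), and T^(phi, x) f is phi composed with u x.  So uniform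
    integrability follows once the norms t |-> |(u x)(t)|, for x in B, have
    uniformly small integrals over small sets ([uniform_mass]).  If they do
    not, let eta > 0 be the largest mass that elements of u(B) can keep on
    sets of arbitrarily small measure.  Choose x_n in B and sets E_n whose
    measures decrease so fast that u x_n has mass almost eta on E_n and
    almost no mass on the union of the later E_m.  By maximality of eta the
    union of all the E_m carries at most about eta of the mass of u x_n.
    Hence, after disjointification, u x_n has nearly eta on its own piece and
    almost nothing on all the other pieces together.  Integrating the norm of
    a combination of the u x_n piece by piece bounds it below by
    (eta / 2) times the sum of the absolute values of the coefficients
    ([chain_lower_bound]).  As u is bounded, (x_n) is then equivalent to the
    unit vector basis of l_1.

    Weak compactness is the Dunford-Pettis argument with ultrafilters.  Along
    an ultrafilter on a bounded uniformly integrable set, the integrals over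
    each measurable set E converge; the limit is an absolutely continuous set
    function of E, so it has a density h ([radon_nikodym_ac]).  Convergence
    of all integrals over measurable sets to those of h is weak convergence
    to h on bounded sets ([cvg_weak_lint]), because every functional on L_1
    is, in the dual norm, a limit of finite combinations of such integrals
    ([dual_step_approx]).

    For a sequence S_n of components, weak limits along one free ultrafilter
    define a bounded operator S_0.  A subsequence is then extracted along
    which the integral over E of S_n 1_D tends to that of S_0 1_D for all D
    and E in a countable family of rays ([subsequence_countable]).  Uniform
    integrability propagates this convergence to all Borel E, and uniform
    boundedness of the S_n propagates it to all Borel D and then to all f, by
    density of simple functions ([wot_subsequence]). *)

(** * Integrating the norm of an integrable function over a measurable set *)

Section mass.
Context d (T : measurableType d) (R : realType).
Variables (mu : {measure set T -> \bar R}) (X : normedModType R).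
Implicit Types (u v : L1 mu X) (E F : set T).

Definition mass E u : R := \int[mu]_(t in E) `|u t|.

Lemma L1_norm_integrable E u : measurable E ->
  mu.-integrable E (EFin \o (fun t => `|u t|)).
Proof.
move=> mE; apply: (@integrableS _ _ _ mu setT) => //.
apply/integrableP; split; first exact: L1fun_norm_measurable.
under eq_integral do rewrite /= normr_id.
by have := L1fun_fin u; rewrite ge0_fin_numE ?integral_ge0.
Qed.

Let measurable_norm E u :
  measurable_fun E ((fun t => `|u t|%:E) : T -> \bar R).
Proof. exact: (measurable_funTS (L1fun_norm_measurable u)). Qed.
Local Hint Resolve measurable_norm : core.

Lemma mass_setT u : mass setT u = `|u|.
Proof. by []. Qed.

Lemma mass_ge0 E u : 0 <= mass E u.
Proof. by apply: Rintegral_ge0 => t _. Qed.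

Lemma mass_set0 u : mass set0 u = 0.
Proof. exact: Rintegral_set0. Qed.

Lemma massU E F u : measurable E -> measurable F -> [disjoint E & F] ->
  mass (E `|` F) u = mass E u + mass F u.
Proof.
move=> mE mF EF; apply: Rintegral_setU => //.
by apply: L1_norm_integrable; exact: measurableU.
Qed.

Lemma massDS E F u : measurable E -> measurable F -> F `<=` E ->
  mass (E `\` F) u = mass E u - mass F u.
Proof.
move=> mE mF FE.
have EF : [disjoint E `\` F & F] by apply/disj_setPS => t [[]].
rewrite -[in RHS](setDUK FE) setUC massU//; last exact: measurableD.
by rewrite addrK.
Qed.

Lemma le_mass E F u : measurable E -> measurable F -> E `<=` F ->
  mass E u <= mass F u.
Proof. by move=> mE mF EF; rewrite -subr_ge0 -massDS// mass_ge0. Qed.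

Lemma mass_le_norm E u : measurable E -> mass E u <= `|u|.
Proof. by move=> mE; rewrite -mass_setT le_mass. Qed.

Lemma massD E u v : measurable E -> mass E (u + v) <= mass E u + mass E v.
Proof.
move=> mE; rewrite -RintegralD//; [|exact: L1_norm_integrable..].
rewrite /mass /Rintegral; apply: fine_le.
- by apply: integrable_fin_num => //; exact: L1_norm_integrable.
- apply: integrable_fin_num => //.
  exact: (integrableD mE (L1_norm_integrable u mE) (L1_norm_integrable v mE)).
apply: ae_ge0_le_integral => //.
- by under eq_fun do rewrite EFinD; exact: emeasurable_funD.
by apply: filterS (L1_reprD u v) => t /= -> _; rewrite lee_fin ler_normD.
Qed.

Lemma massZ E (a : R) u : measurable E -> mass E (a *: u) = `|a| * mass E u.
Proof.
move=> mE; rewrite -RintegralZl//; last exact: L1_norm_integrable.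
rewrite /mass /Rintegral; congr fine; apply: ge0_ae_eq_integral => //.
- by under eq_fun do rewrite EFinM; exact: measurable_funeM.
by apply: filterS (L1_reprZ a u) => t /= -> _; rewrite normrZ.
Qed.

Lemma mass_sum E I (r : seq I) (P : pred I) (u : I -> L1 mu X) :
  measurable E ->
  mass E (\sum_(i <- r | P i) u i) <= \sum_(i <- r | P i) mass E (u i).
Proof.
move=> mE; elim/big_ind2 : _ => // [|v y w z vy wz].
  by rewrite -(scale0r (0 : L1 mu X)) massZ// normr0 mul0r.
exact: le_trans (massD _ _ mE) (lerD vy wz).
Qed.

Lemma mass_continuous u (e : R) : 0 < e -> exists2 del : R, 0 < del &
  forall E, measurable E -> (mu E < del%:E)%E -> mass E u < e.
Proof.
move=> e0; have := @integral_normr_continuous _ _ _ mu (fun t => `|u t|)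
  (L1_norm_integrable u measurableT) e e0.
move=> [del [del0 H]]; exists del => // E mE Ed; have := H E mE Ed.
by under eq_Rintegral do rewrite normr_id.
Qed.

End mass.

(** * Operators into an L1 space and sequences equivalent to the l1 basis *)

Section chain.
Context d (T : measurableType d) (R : realType).
Variables (mu : {measure set T -> \bar R}) (V X : normedModType R).
Variables (u : bop V (L1 mu X)).

(* The pieces U n `\` U n.+1 of a finite decreasing chain are disjoint, so a
   chain encodes disjoint sets without any bookkeeping of disjointness. *)
Variables (N : nat) (x : nat -> V) (U : nat -> set T) (b c : R).
Hypothesis mU : forall n, measurable (U n).
Hypothesis decU : forall n, U n.+1 `<=` U n.
Hypothesis UN : U N = set0.

Lemma telescope_mass (w : L1 mu X) :
  mass (U 0%N) w = \sum_(n < N) mass (U n `\` U n.+1) w.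
Proof.
under eq_bigr do rewrite massDS//.
rewrite -(big_mkord xpredT (fun n => mass (U n) w - mass (U n.+1) w)).
rewrite (@telescope_sumr_eq _ _ _ (fun n => - mass (U n) w))//.
  by rewrite UN mass_set0 oppr0 add0r opprK.
by move=> k _; rewrite opprK addrC.
Qed.

Hypothesis massU0 : forall n, (n < N)%N -> mass (U 0%N) (u (x n)) <= b.
Hypothesis massUn :
  forall n, (n < N)%N -> c <= mass (U n `\` U n.+1) (u (x n)).

(** On the n-th piece the triangle inequality gives at least twice the mass of
    the n-th term minus the masses of all the terms.  Summed over the pieces,
    the i-th coefficient is multiplied by twice the mass on its own piece minus
    its mass on the whole of [U 0]. *)
Lemma chain_lower_bound (a : nat -> R) :
  (2 * c - b) * (\sum_(i < N) `|a i|) <= `|u (\sum_(i < N) a i *: x i)|.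
Proof.
set w := u _; have mD n : measurable (U n `\` U n.+1) by exact: measurableD.
apply: le_trans (mass_le_norm w (mU 0%N)); rewrite telescope_mass.
have wE : w = \sum_(i < N) a i *: u (x i).
  by rewrite /w linear_sum; apply: eq_bigr => i _; rewrite linearZ.
have low (n : 'I_N) : 2 * (`|a n| * mass (U n `\` U n.+1) (u (x n))) -
    \sum_(i < N) `|a i| * mass (U n `\` U n.+1) (u (x i)) <=
    mass (U n `\` U n.+1) w.
  have E : a n *: u (x n) = w - \sum_(i < N | i != n) a i *: u (x i).
    by rewrite wE (bigD1 n)//= addrK.
  have := massD w (- \sum_(i < N | i != n) a i *: u (x i)) (mD n).
  rewrite -E massZ// -scaleN1r massZ// normrN1 mul1r => H.
  have K : mass (U n `\` U n.+1) (\sum_(i < N | i != n) a i *: u (x i)) <=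
      \sum_(i < N | i != n) `|a i| * mass (U n `\` U n.+1) (u (x i)).
    apply: le_trans (mass_sum _ _ _ (mD n)) _.
    by apply: ler_sum => i _; rewrite massZ.
  rewrite (bigD1 n)//=; lra.
have total :
    \sum_(n < N) \sum_(i < N) `|a i| * mass (U n `\` U n.+1) (u (x i)) =
    \sum_(i < N) `|a i| * mass (U 0%N) (u (x i)).
  rewrite exchange_big/=; apply: eq_bigr => i _.
  by rewrite telescope_mass mulr_sumr.
apply: le_trans (ler_sum _ (fun n _ => low n)).
rewrite sumrB total -mulr_sumr.
rewrite !mulr_sumr -sumrB; apply: ler_sum => i _.
have := massU0 (ltn_ord i); have := massUn (ltn_ord i).
have := normr_ge0 (a i); nra.
Qed.

End chain.

Lemma bounded_setP (R : realType) (W : normedModType R) (D : set W) :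
  bounded_set D ->
  exists2 K : R, 0 < K & forall x, D x -> `|x| <= K.
Proof.
move=> [M [_ HM]]; exists (`|M| + 1); first by rewrite ltr_wpDl.
by apply: HM; rewrite (le_lt_trans (ler_norm M))// ltrDl.
Qed.

Section ell1_uniform.
Context d (T : measurableType d) (R : realType).
Variables (mu : {measure set T -> \bar R}) (V X : normedModType R).
Variables (u : bop V (L1 mu X)) (B : set V).

Lemma lower_bound_equiv_ell1 (x : nat -> V) (c : R) : bounded_set B ->
  (forall n, B (x n)) -> 0 < c ->
  (forall N (a : nat -> R),
    c * (\sum_(i < N) `|a i|) <= `|u (\sum_(i < N) a i *: x i)|) ->
  equiv_ell1 x.
Proof.
move=> /bounded_setP[K K0 HK] Bx c0 H; have [M M0 HM] := bop_bound u.
exists (c / (M + 1)), K; split => // [|N a];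
  first by rewrite divr_gt0// ltr_wpDl.
split.
  rewrite mulrAC ler_pdivrMr ?ltr_wpDl// (le_trans (H N a))//.
  by rewrite (le_trans (HM _))// mulrC ler_wpM2l// lerDl.
rewrite (le_trans (ler_norm_sum _ _ _))// mulr_sumr ler_sum// => i _.
by rewrite normrZ mulrC ler_wpM2r// HK.
Qed.

(** If small sets could keep a fixed mass of elements of u(B), a sequence in B
    would be equivalent to the l_1 basis.  [eta] is the supremum of the masses
    that survive on sets of arbitrarily small measure, and the losses in the
    construction add up to 5 * eps = eta / 2. *)
Lemma uniform_mass : bounded_set B ->
  (~ exists x : nat -> V, (forall n, B (x n)) /\ equiv_ell1 x) ->
  forall e : R, 0 < e -> exists2 del : R, 0 < del &
    forall x E, B x -> measurable E -> (mu E < del%:E)%E -> mass E (u x) < e.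
Proof.
move=> bB noell1 e e0; apply: contrapT => H; apply: noell1.
have [K K0 HK] := bounded_setP bB; have [M M0 HM] := bop_bound u.
pose bad c (del : R) (p : V * set T) :=
  [/\ B p.1, measurable p.2, (mu p.2 < del%:E)%E & c <= mass p.2 (u p.1)].
pose Z := [set c : R | forall del : R, 0 < del -> exists p, bad c del p].
have Ze : Z e.
  move=> del del0; apply: contrapT => K1; apply: H;
    exists del => // x E Bx mE Ed.
  by rewrite ltNge; apply/negP => ?; apply: K1; exists (x, E).
have supZ : has_sup Z.
  split; first by exists e.
  exists (M * K) => c /(_ 1 ltr01)[[x E] [/= Bx mE _ cE]].
  apply: le_trans cE _; rewrite (le_trans (mass_le_norm _ mE))//.
  by rewrite (le_trans (HM x))// ler_wpM2l// HK.
set eta := sup Z.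
have eta0 : 0 < eta by apply: lt_le_trans e0 _; exact: ub_le_sup supZ.2 _ Ze.
pose eps := eta / 10.
have eps0 : 0 < eps by rewrite divr_gt0.
have [c Zc etac] := sup_adherent eps0 supZ.
have [del0 del00 Hdel0] : exists2 del : R, 0 < del & forall x E, B x ->
    measurable E -> (mu E < del%:E)%E -> mass E (u x) < eta + eps.
  apply: contrapT => H1; suff /(ub_le_sup supZ.2) : Z (eta + eps).
    by rewrite -/eta gerDl leNgt eps0.
  move=> del del0; apply: contrapT => K1; apply: H1;
    exists del => // x E Bx mE Ed.
  by rewrite ltNge; apply/negP => ?; apply: K1; exists (x, E).
have /choice[P HP] : forall r : R, exists p, 0 < r -> bad c r p.
  move=> r; have [r0|_] := ltP 0 r; last by exists (0, set0).
  by have [p Hp] := Zc r r0; exists p.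
have /choice[D HD] : forall x, exists r : R, 0 < r /\ forall E, measurable E ->
    (mu E < r%:E)%E -> mass E (u x) < eps.
  by move=> x; have [r r0 Hr] := mass_continuous (u x) eps0; exists r.
(* [r n] bounds the measure of the n-th set; halving makes the tail after n
   measure less than 2 * r n.+1, which [D] keeps harmless for u (x n). *)
pose r n := iter n (fun s => Num.min (s / 2) (D (P s).1 / 2)) (del0 / 2).
have r0 n : 0 < r n.
  elim: n => [|n IH] /=; first by rewrite divr_gt0.
  by rewrite lt_min !divr_gt0//; case: (HD (P (r n)).1).
pose x n := (P (r n)).1; pose E n := (P (r n)).2.
have badE n : bad c (r n) (x n, E n).
  by have := HP _ (r0 n); rewrite /x /E; case: (P (r n)).
have rS n : r n.+1 <= r n / 2 by rewrite /= ge_min lexx.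
have rD n : r n.+1 <= D (x n) / 2 by rewrite /= ge_min lexx orbT.
have mE n : measurable (E n) by case: (badE n).
have Bx n : B (x n) by case: (badE n).
exists x; split => //; apply: (@lower_bound_equiv_ell1 _ (eta / 2)) => //.
  by rewrite divr_gt0.
(* Only the tails up to N enter the estimate of a combination of N terms, so
   that finite unions suffice. *)
move=> N a; pose U n := \big[setU/set0]_(n <= m < N) E m.
have mU n : measurable (U n) by exact: bigsetU_measurable.
have UN n : (N <= n)%N -> U n = set0 by move=> Nn; rewrite /U big_geq.
have US n : (n < N)%N -> U n = E n `|` U n.+1 by move=> nN; rewrite /U big_ltn.
have decU n : U n.+1 `<=` U n.
  have [Nn|nN] := leqP N n; first by rewrite UN// ltnW.
  by rewrite (US n)//; exact: subsetUr.
have muU n : (mu (U n) < (2 * r n)%:E)%E.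
  have [k Nk] : exists k, (N <= n + k)%N by exists N; rewrite leq_addl.
  elim: k n Nk => [|k IH] n Nk.
    by rewrite addn0 in Nk; rewrite UN// measure0 lte_fin mulr_gt0.
  have [Nn|nN] := leqP N n; first by rewrite UN// measure0 lte_fin mulr_gt0.
  rewrite (US n)//; apply: le_lt_trans (measureU2 _ _ _) _ => //.
  have /IH IHn : (N <= n.+1 + k)%N by rewrite addSnnS.
  have [_ _ /= En _] := badE n.
  apply: lt_le_trans (lteD En IHn) _.
  by rewrite -EFinD lee_fin; have := rS n; lra.
have -> : eta / 2 = 2 * (eta - 2 * eps) - (eta + eps) by rewrite /eps; lra.
apply: (@chain_lower_bound _ _ _ mu V X u N x U) => // [|n nN|n nN].
- exact: UN.
- apply/ltW/Hdel0 => //; apply: lt_le_trans (muU 0%N) _.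
  by rewrite lee_fin /r /=; lra.
- have [_ _ _ /= cE] := badE n.
  have En : E n `<=` U n by rewrite (US n)//; exact: subsetUl.
  have small : mass (U n.+1) (u (x n)) < eps.
    apply: (HD (x n)).2 => //; apply: lt_le_trans (muU n.+1) _.
    by rewrite lee_fin; have := rD n; lra.
  have := le_mass (u (x n)) (mE n) (mU n) En.
  rewrite massDS//; move: etac; rewrite -/eta; lra.
Qed.

End ell1_uniform.

(** * Integrals of scalar integrable functions over measurable sets *)

Section scalar.
Context d (T : measurableType d) (R : realType).
Variables (mu : {measure set T -> \bar R}).
Implicit Types (f g : L1 mu R^o) (E F : set T).

Definition lint E f : R := \int[mu]_(t in E) (f t : R).

Lemma L1_integrableS E f : measurable E ->
  mu.-integrable E (EFin \o (f : T -> R)).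
Proof. by move=> mE; apply: integrableS (L1_integrable f). Qed.

Lemma lint_EFin E f : measurable E ->
  (lint E f)%:E = (\int[mu]_(t in E) (f t : R)%:E)%E.
Proof.
by move=> mE; rewrite /lint fineK//; apply: integrable_fin_num => //;
  exact: L1_integrableS.
Qed.

Lemma lint_linear E : measurable E -> linear (lint E : L1 mu R^o -> R^o).
Proof.
move=> mE a f g.
transitivity (\int[mu]_(t in E) (a * (L1_repr f t : R) + (L1_repr g t : R))).
  rewrite /lint /Rintegral; congr fine; apply: ae_eq_integral => //.
  - exact: measurable_int (L1_integrableS _ mE).
  - under eq_fun do rewrite EFinD EFinM.
    apply: emeasurable_funD; first apply: measurable_funeM.
      exact: measurable_int (L1_integrableS f mE).
    exact: measurable_int (L1_integrableS g mE).
  by apply: filterS (L1_repr_linear a f g) => t /= ->.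
rewrite RintegralD//; last exact: L1_integrableS.
  by rewrite RintegralZl//; exact: L1_integrableS.
have := integrableZl mE a (L1_integrableS f mE).
by apply: eq_integrable => // t _ /=; rewrite EFinM.
Qed.

Lemma lintD E f g : measurable E -> lint E (f + g) = lint E f + lint E g.
Proof. by move=> mE; have := lint_linear mE 1 f g; rewrite !scale1r. Qed.

Lemma lint0 E : measurable E -> lint E 0 = 0.
Proof. by move=> mE; have := lintD 0 0 mE; rewrite addr0; lra. Qed.

Lemma lintZ E (a : R) f : measurable E -> lint E (a *: f) = a * lint E f.
Proof.
by move=> mE; have := lint_linear mE a f 0; rewrite lint0// !addr0.
Qed.

Lemma lintB E f g : measurable E -> lint E (f - g) = lint E f - lint E g.
Proof. by move=> mE; rewrite -scaleN1r lintD// lintZ// mulN1r. Qed.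

Lemma lint_sum E I (r : seq I) (P : pred I) (F : I -> L1 mu R^o) :
  measurable E -> lint E (\sum_(i <- r | P i) F i) =
    \sum_(i <- r | P i) lint E (F i).
Proof.
by move=> mE; apply: (big_morph _ (fun f g => lintD f g mE) (lint0 mE)).
Qed.

Lemma lintU E F f : measurable E -> measurable F -> [disjoint E & F] ->
  lint (E `|` F) f = lint E f + lint F f.
Proof.
move=> mE mF EF; apply: Rintegral_setU => //.
by apply: L1_integrableS; exact: measurableU.
Qed.

Lemma lint_mass E f : measurable E -> `|lint E f| <= mass E f.
Proof. by move=> mE; apply: le_normr_Rintegral => //;
  exact: L1_integrableS. Qed.

Lemma lint_le_norm E f : measurable E -> `|lint E f| <= `|f|.
Proof. by move=> mE; rewrite (le_trans (lint_mass _ mE))// mass_le_norm. Qed.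

Lemma lint_inj f g : (forall E, measurable E -> lint E f = lint E g) -> f = g.
Proof.
move=> fg; apply/L1_eq.
have : ae_eq mu setT (EFin \o (f : T -> R)) (EFin \o (g : T -> R)).
  apply: integral_ae_eq => //; first exact: L1_integrable.
    exact: measurable_int (L1_integrable g).
  by move=> E _ mE; rewrite /= -!lint_EFin// fg.
by apply: filterS => t /(_ Logic.I) /= [].
Qed.

(** Split the domain according to the sign of f. *)
Lemma norm_le_lint f (M : R) :
  (forall E, measurable E -> `|lint E f| <= M) -> `|f| <= 2 * M.
Proof.
move=> H.
have mf : measurable_fun setT (f : T -> R) by exact: L1_repr_measurable.
pose P := [set t | 0 <= (f t : R)].
have mP : measurable P.
  have := mf measurableT `[0, +oo[%classic (measurable_itv _).
  rewrite setTI; congr (measurable _); apply/seteqP.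
  by split => t /=; rewrite in_itv/= andbT.
have mCP : measurable (~` P) by exact: measurableC.
have E1 : mass P f = lint P f.
  by apply: eq_Rintegral => t; rewrite inE /P /= => /ger0_norm.
have E2 : mass (~` P) f = - lint (~` P) f.
  rewrite -mulN1r /lint -RintegralZl//; last exact: L1_integrableS.
  apply: eq_Rintegral => t; rewrite inE /P /= mulN1r => /negP.
  by rewrite -ltNge => /ltW /ler0_norm.
have /= -> : `|f| = mass P f + mass (~` P) f.
  rewrite -massU//; last by apply/disj_setPS => t [].
  by rewrite setUv mass_setT.
have := H _ mP; have := H _ mCP; rewrite !ler_norml E1 E2; lra.
Qed.

(** Real-valued measurable functions are pointwise limits of simple functions,
    hence strongly measurable. *)
Lemma L1_of_integrable (h : T -> R) : mu.-integrable setT (EFin \o h) ->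
  exists f : L1 mu R^o, {ae mu, forall t, f t = h t}.
Proof.
move=> ih; have mh := measurable_int _ ih.
have hb : (h : T -> R^o) \in bochner mu R^o.
  apply/bochnerP; split.
    have [s hs] := approximation_sfun measurableT mh.
    exists (fun n => s n : T -> R^o).
      by move=> n; split => [|v]; [exact: fimfunP|exact: measurable_sfunP].
    by move=> t; have /fine_cvgP[_] := hs t Logic.I.
  by case/integrableP : ih.
by exists (L1_class (L1Fun hb)); exact: L1_classE.
Qed.

End scalar.

(** * Radon-Nikodym for set functions given by epsilon-delta continuity *)

(** Lets the finiteness of a given measure be used where the bundled structure
    of finite measures is required. *)
Lemma finite_measureP d (T : measurableType d) (R : realType)
  (mu : {measure set T -> \bar R}) : fin_num_fun mu ->
  exists m : {finite_measure set T -> \bar R},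
    m = mu :> {measure set T -> \bar R}.
Proof.
case: mu => m [m1 m2] /= finm.
pose mM := Measure.Pack (Measure.Class m2).
pose muF := @Measure_isFinite.Axioms_ d T R m m1 m2 finm.
pose fm : {finite_measure set T -> \bar R} := HB.pack m mM muF.
by exists fm.
Qed.

Section finite.
Context d (T : measurableType d) (R : realType).
Variables (mu : {measure set T -> \bar R}) (finmu : fin_num_fun mu).
Implicit Types (f g : L1 mu R^o) (D E F : set T).

Lemma cvg_tail0 (F : nat -> set T) : (forall n, measurable (F n)) ->
  forall e : R, 0 < e -> \forall n \near \oo,
    (mu (\bigcup_k F k `\` \big[setU/set0]_(0 <= i < n) F i) < e%:E)%E.
Proof.
move=> mF e e0.
pose G n := \bigcup_k F k `\` \big[setU/set0]_(0 <= i < n) F i.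
have mG n : measurable (G n).
  by apply: measurableD; [exact: bigcup_measurable|exact: bigsetU_measurable].
have G0 : \bigcap_n G n = set0.
  apply/seteqP; split => // t Gt.
  have [[k _ Fkt] _] := Gt 0%N Logic.I.
  have [_ []] := Gt k.+1 Logic.I.
  by rewrite big_nat_recr//=; right.
have /fine_cvgP[Gfin /cvgrPdist_lt/(_ e e0) Glt] :
  mu (G n) @[n --> \oo] --> 0%E.
  rewrite -(measure0 mu) -G0; apply: nonincreasing_cvg_mu => //.
  - by rewrite ltey_eq finmu.
  - by rewrite G0.
  - apply/nonincreasing_seqP => n; apply/subsetPset => t [Ft nt]; split => //.
    by move=> h; apply: nt; rewrite big_nat_recr//=; left.
apply: filterS2 Gfin Glt => n nfin /=.
rewrite sub0r normrN => Gn; rewrite -(fineK nfin) lte_fin.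
exact: le_lt_trans (ler_norm _) Gn.
Qed.

(** The tails of a disjoint union have vanishing measure, so continuity turns
    finite additivity into sigma-additivity; then Radon-Nikodym applies. *)
Lemma radon_nikodym_ac (nu : set T -> R) :
  (forall E F, measurable E -> measurable F -> [disjoint E & F] ->
    nu (E `|` F) = nu E + nu F) ->
  (forall e, 0 < e -> exists2 del : R, 0 < del &
    forall E, measurable E -> (mu E < del%:E)%E -> `|nu E| <= e) ->
  exists f : L1 mu R^o, forall E, measurable E -> nu E = lint E f.
Proof.
move=> addnu acnu.
have nu0 : nu set0 = 0.
  have := addnu set0 set0 measurable0 measurable0; rewrite setU0.
  have -> : [disjoint (@set0 T) & set0] by apply/disj_setPS => t [].
  by move=> /(_ isT); lra.
have nuD E F : measurable E -> measurable F -> F `<=` E ->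
    nu E = nu F + nu (E `\` F).
  move=> mE mF FE; rewrite -addnu ?setDUK//; first exact: measurableD.
  by apply/disj_setPS => t [? []].
pose en := EFin \o nu.
have en0 : en set0 = 0%E by rewrite /en /= nu0.
have enfin E : measurable E -> en E \is a fin_num by [].
have ensig : semi_sigma_additive en.
  move=> F mF tF mUF.
  have S n : (\sum_(0 <= i < n) en (F i) =
      (nu (\big[setU/set0]_(0 <= i < n) F i))%:E)%E.
    elim: n => [|n IH]; first by rewrite !big_geq// nu0.
    rewrite !big_nat_recr//= IH addnu//; first exact: bigsetU_measurable.
    apply/disj_setPS; rewrite big_mkord -bigcup_mkord => t [[i /= ik Fit] Fnt].
    have E : i = n by apply: tF => //; exists t.
    by move: ik; rewrite E ltnn.
  under eq_fun do rewrite S.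
  apply: cvg_EFin; first exact: nearW.
  apply/cvgrPdist_le => e e0; have [del del0 Hdel] := acnu e e0.
  near=> n.
  have mn : measurable (\big[setU/set0]_(0 <= i < n) F i).
    exact: bigsetU_measurable.
  rewrite /= (nuD _ _ mUF mn); last first.
    by rewrite big_mkord -bigcup_mkord => t [i _ Fit]; exists i.
  rewrite addrAC subrr add0r; apply: Hdel; first exact: measurableD.
  by near: n; exact: cvg_tail0.
pose enC := isCharge.Build _ T R en en0 enfin ensig.
pose enu : {charge set T -> \bar R} := HB.pack en enC.
have [fmu fmuE] := finite_measureP finmu.
have dom : enu `<< fmu.
  move=> N N0 E mE EN; congr (_%:E); apply/eqP; rewrite -normr_le0 leNgt.
  apply/negP => nuE; have nuE2 : 0 < `|nu E| / 2 by rewrite divr_gt0.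
  have [del del0 Hdel] := acnu _ nuE2.
  suff : `|nu E| <= `|nu E| / 2 by lra.
  have muE0 : mu E = 0%E by rewrite -fmuE; exact: (N0 E mE EN).
  by apply: Hdel => //; rewrite muE0.
have ih : mu.-integrable setT (Radon_Nikodym enu fmu).
  by rewrite -fmuE; exact: Radon_Nikodym_integrable.
have hE E : measurable E -> enu E = (\int[mu]_(t in E)
  Radon_Nikodym enu fmu t)%E.
  by rewrite -fmuE; exact: Radon_Nikodym_integral.
pose h t := fine (Radon_Nikodym enu fmu t).
have hfin t : (h t)%:E = Radon_Nikodym enu fmu t.
  by rewrite /h fineK// Radon_Nikodym_fin_num.
have [f fh] : exists f : L1 mu R^o, {ae mu, forall t, f t = h t}.
  apply: L1_of_integrable; apply: eq_integrable ih => // t _ /=.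
  by rewrite hfin.
exists f => E mE; apply: EFin_inj; rewrite lint_EFin//.
rewrite -[LHS]/(enu E) hE//.
apply: ae_eq_integral => //.
- apply: (measurable_funS measurableT) => //; exact: measurable_int ih.
- exact: measurable_int (L1_integrableS f mE).
by apply: filterS fh => t /= -> _; rewrite hfin.
Unshelve. all: by end_near. Qed.

(** * Indicator functions as elements of L1 *)

(** A total function of the set, so that set functions such as
    D |-> psi (ind D) are defined without carrying measurability proofs; the
    value is 0 when no class represents the indicator. *)
Definition ind D : L1 mu R^o :=
  xget 0 [set f : L1 mu R^o | {ae mu, forall t, f t = \1_D t}].

Lemma indE D : measurable D -> {ae mu, forall t, ind D t = \1_D t}.
Proof.
move=> mD; rewrite /ind; case: xgetP => [f -> //|]/=.
have [|f fD] := @L1_of_integrable _ _ _ mu \1_D; last by move=> /(_ f).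
apply/integrableP; split; first exact/measurable_EFinP/measurable_indic.
have -> : (\int[mu]_x `|(EFin \o \1_D) x| = \int[mu]_x (\1_D x)%:E)%E.
  by apply: eq_integral => t _ /=; rewrite ger0_norm.
by rewrite integral_indic// setIT ltey_eq finmu.
Qed.

Lemma lint_ind D E : measurable D -> measurable E ->
  lint E (ind D) = fine (mu (D `&` E)).
Proof.
move=> mD mE; rewrite -integral_indic// /lint /Rintegral; congr fine.
apply: ae_eq_integral => //.
- exact: measurable_int (L1_integrableS _ mE).
- by apply: measurable_funTS; exact/measurable_EFinP/measurable_indic.
by apply: filterS (indE mD) => t /= ->.
Qed.

Lemma lint_indC D E : measurable D -> measurable E ->
  lint E (ind D) = lint D (ind E).
Proof. by move=> mD mE; rewrite !lint_ind// setIC. Qed.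

Lemma norm_ind D : measurable D -> `|ind D| = fine (mu D).
Proof.
move=> mD; rewrite -[in RHS](setIT D) -lint_ind// -mass_setT.
rewrite /mass /lint /Rintegral; congr fine; apply: ae_eq_integral => //.
- exact: measurable_int (L1_norm_integrable _ measurableT).
- exact: measurable_int (L1_integrable _).
by apply: filterS (indE mD) => t /= -> _; rewrite ger0_norm.
Qed.

Lemma indU D E : measurable D -> measurable E -> [disjoint D & E] ->
  ind (D `|` E) = ind D + ind E.
Proof.
move=> mD mE DE; have mDE := measurableU _ _ mD mE.
apply: lint_inj => F mF; rewrite lintD// !(lint_indC _ mF)//.
exact: lintU.
Qed.

End finite.

(** * Simple functions, and functionals on L1 *)

Section simple.
Context d (T : measurableType d) (R : realType).
Variables (mu : {measure set T -> \bar R}) (finmu : fin_num_fun mu).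
Implicit Types (f g : L1 mu R^o) (E : set T).

Lemma L1_norm_int (V : normedModType R) (u : L1 mu V) :
  ((`|u|)%:E = \int[mu]_t (`|u t|)%:E)%E.
Proof. exact: L1_normE. Qed.

Lemma L1_repr_sum (V : normedModType R) I (r : seq I) (F : I -> L1 mu V) :
  {ae mu, forall t, (\sum_(i <- r) F i : L1 mu V) t = \sum_(i <- r) F i t}.
Proof.
elim: r => [|i r IH].
  rewrite big_nil; apply: filterS (L1_repr0 mu V) => t /= ->.
  by rewrite big_nil.
rewrite big_cons; apply: filterS2 IH (L1_reprD (F i) (\sum_(j <- r) F j))
  => t /=.
by rewrite big_cons => <-.
Qed.

Definition step n (c : 'I_n -> R) (D : 'I_n -> set T) : L1 mu R^o :=
  \sum_(i < n) c i *: ind mu (D i).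

Lemma stepE n (c : 'I_n -> R) (D : 'I_n -> set T) :
  (forall i, measurable (D i)) ->
  {ae mu, forall t, step c D t = \sum_(i < n) c i * \1_(D i) t}.
Proof.
move=> mD; have H : {ae mu, forall t (i : 'I_n),
    (c i *: ind mu (D i) : L1 mu R^o) t = c i * \1_(D i) t}.
  apply: (@filter_forall _ _ (fun i t => (c i *: ind mu (D i) :
    L1 mu R^o) t = c i * \1_(D i) t)) => i.
  by apply: filterS2 (L1_reprZ (c i) (ind mu (D i))) (indE finmu (mD i))
    => t /= -> ->.
apply: filterS2 H (L1_repr_sum (index_enum 'I_n) (fun i =>
  c i *: ind mu (D i))) => t Ht /= ->.
exact: eq_bigr.
Qed.

Lemma step_disjointE n (c : 'I_n -> R) (D : 'I_n -> set T) (i : 'I_n) t :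
  trivIset setT D -> D i t -> \sum_(j < n) c j * \1_(D j) t = c i.
Proof.
move=> tD Dit; rewrite (bigD1 i)//= big1 => [|j ji].
  by rewrite indicE mem_set// mulr1 addr0.
rewrite indicE memNset ?mulr0// => Djt.
by move/eqP: ji; apply; apply: tD => //; exists t.
Qed.

(** The step function with coefficients |c i| has the same norm, and its
    integral is the left-hand side. *)
Lemma norm_step n (c : 'I_n -> R) (D : 'I_n -> set T) :
  (forall i, measurable (D i)) -> trivIset setT D ->
  \sum_(i < n) `|c i| * fine (mu (D i)) <= `|step c D|.
Proof.
move=> mD tD.
have -> : \sum_(i < n) `|c i| * fine (mu (D i)) =
    lint setT (step (fun i => `|c i|) D).
  rewrite /step lint_sum//; apply: eq_bigr => i _.
  by rewrite lintZ// lint_ind// setIT.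
have -> : `|step c D| = `|step (fun i => `|c i|) D|.
  apply: EFin_inj; rewrite !L1_norm_int.
  apply: ge0_ae_eq_integral => //; try exact: L1fun_norm_measurable.
  apply: filterS2 (stepE c mD) (stepE (fun i => `|c i|) mD) => t /= -> -> _.
  congr (_%:E); have [[i Dit]|none] := pselect (exists i, D i t).
    by rewrite !(step_disjointE _ tD Dit) normr_id.
  by rewrite !big1 => [//|i _|i _]; rewrite indicE memNset ?mulr0// => Dit;
    apply: none; exists i.
by apply: le_trans (ler_norm _) _; exact: lint_le_norm.
Qed.

Lemma step_dense f (e : R) : 0 < e ->
  exists n (c : 'I_n -> R) (D : 'I_n -> set T),
    [/\ forall i, measurable (D i), trivIset setT D & `|f - step c D| < e].
Proof.
move=> e0; have [g [ig _ gcvg]] :=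
  approximation_sfun_integrable measurableT (L1_integrable f).
have [k gk] : exists k, (\int[mu]_t `|(f t : R)%:E - (g k t)%:E| < e%:E)%E.
  have /fine_cvgP[gfin /cvgrPdist_lt/(_ e e0) glt] := gcvg.
  have [k [kfin klt]] := filter_ex (filterI gfin glt).
  exists k; rewrite -(fineK kfin) lte_fin.
  by apply: le_lt_trans (ler_norm _) _; rewrite -normrN -sub0r.
set s := fset_set (range (g k)).
pose D (i : 'I_#|` s|) := g k @^-1` [set s`_i].
have mD i : measurable (D i) by exact: measurable_sfunP.
have tD : trivIset setT D.
  move=> i j _ _ [t [Dit Djt]]; have /eqP := etrans (esym Dit) Djt.
  by rewrite nth_uniq ?fset_uniq// => /eqP/val_inj.
exists #|` s|, (fun i => s`_i), D; split => //.
rewrite -lte_fin; apply: le_lt_trans gk.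
rewrite L1_norm_int; apply: ae_ge0_le_integral => //.
- exact: L1fun_norm_measurable.
- by apply/measurable_EFinP/measurableT_comp => //;
  apply: measurable_funB => //; exact: L1_repr_measurable.
apply: filterS2 (L1_repr_linear (-1) (step (fun i =>
  s`_i) D) f) (stepE (fun i => s`_i) mD) => t.
rewrite scaleN1r addrC => /= -> -> _.
by rewrite -fimfunEord /= lee_fin scaleN1r addrC.
Qed.

(** In L_1 the dual norm is determined by indicators, because the norm is
    additive over the disjoint terms of a step function. *)
Lemma le_norm_ind (L : L1 mu R^o -> R) (M e : R) : 0 <= e ->
  linear (L : L1 mu R^o -> R^o) -> (forall f, `|L f| <= M * `|f|) ->
  (forall D, measurable D -> `|L (ind mu D)| <= e * fine (mu D)) ->
  forall f, `|L f| <= e * `|f|.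
Proof.
move=> e0 lL LM Lind f; apply/ler_addgt0Pr => r r0.
have M1 : 0 < e + `|M| + 1 by rewrite ltr_wpDl// addr_ge0.
have [n [c [D [mD tD fD]]]] := step_dense f (divr_gt0 r0 M1).
have LB g h : L (g - h) = L g - L h.
  by rewrite addrC -scaleN1r lL scaleN1r addrC.
have Lstep : `|L (step c D)| <= e * `|step c D|.
  have -> : L (step c D) = \sum_(i < n) c i * L (ind mu (D i)).
    transitivity (bop_of (f := L : L1 mu R^o -> R^o) lL LM (step c D)) => //.
    by rewrite linear_sum; apply: eq_bigr => i _; exact: linearZ.
  apply: le_trans (ler_norm_sum _ _ _) _.
  apply: le_trans (ler_wpM2l e0 (norm_step c mD tD)).
  rewrite mulr_sumr ler_sum// => i _.
  by rewrite normrM mulrCA ler_wpM2l// Lind.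
have H1 : `|L f| <= `|L (f - step c D)| + `|L (step c D)|.
  by rewrite LB (le_trans _ (ler_normD _ _))// subrK.
have H2 : `|step c D| <= `|f| + `|f - step c D|.
  rewrite -[X in `|X| <= _](subKr f) (le_trans (ler_normB _ _))//.
have H3 := LM (f - step c D).
move: fD; rewrite ltr_pdivlMr// => fD.
have H4 := ler_wpM2r (normr_ge0 (f - step c D)) (ler_norm M).
have H5 := ler_wpM2l e0 H2.
have := normr_ge0 (f - step c D); lra.
Qed.

End simple.

Section dual_L1.
Context d (T : measurableType d) (R : realType).
Variables (mu : {measure set T -> \bar R}) (finmu : fin_num_fun mu).
Implicit Types (f g : L1 mu R^o) (D E : set T).

Lemma mass_le_cst (V : normedModType R) (u : L1 mu V) (c : R) D :
  measurable D -> 0 <= c -> {ae mu, forall t, `|u t| <= c} ->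
  mass D u <= c * fine (mu D).
Proof.
move=> mD c0 uc; rewrite -lee_fin /mass /Rintegral fineK; last first.
  by apply: integrable_fin_num => //; exact: L1_norm_integrable.
have -> : (c * fine (mu D))%:E = (\int[mu]_(t in D) c%:E)%E.
  by rewrite integral_cst// EFinM fineK// finmu.
apply: ae_ge0_le_integral => //.
- exact: (measurable_funTS (L1fun_norm_measurable u)).
- by apply: filterS uc => t /= H _; rewrite lee_fin.
Qed.

Lemma ge0_lint E f : measurable E -> {ae mu, forall t, E t -> 0 <= (f t : R)} ->
  0 <= lint E f.
Proof.
move=> mE f0; suff -> : lint E f = mass E f by exact: mass_ge0.
rewrite /lint /mass /Rintegral; congr fine; apply: ae_eq_integral => //.
- exact: measurable_int (L1_integrableS f mE).
- exact: measurable_int (L1_norm_integrable f mE).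
by apply: filterS f0 => t /= H Et; rewrite ger0_norm// H.
Qed.

(** The density of D |-> psi (ind D).  Where it exceeds M + 1 in absolute value,
    the indicator of the set would violate the bound M on psi. *)
Lemma dual_density (psi : dual (L1 mu R^o)) (M : R) : 0 <= M ->
  (forall f, `|psi f| <= M * `|f|) ->
  exists2 g : L1 mu R^o, {ae mu, forall t, `|g t : R| < M + 1} &
    forall E, measurable E -> psi (ind mu E) = lint E g.
Proof.
move=> M0 HM.
have Hind E : measurable E -> `|psi (ind mu E)| <= M * fine (mu E).
  by move=> mE; rewrite (le_trans (HM _))// norm_ind.
have [E F mE mF EF|e e0|g gE] := @radon_nikodym_ac _ _ _ mu finmu (fun E =>
  psi (ind mu E) : R).
- by rewrite indU// linearD.
- exists (e / (M + 1)); first by rewrite divr_gt0// ltr_wpDl.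
  move=> E mE; rewrite -(fineK (finmu mE)) lte_fin ltr_pdivlMr ?ltr_wpDl//
    => He.
  have := Hind E mE; have : 0 <= fine (mu E) by exact: fine_ge0.
  by move: He; lra.
exists g => //.
have null (s : R) : `|s| = 1 -> {ae mu, forall t, s * (g t : R) < M + 1}.
  move=> s1; pose P := [set t | M + 1 <= s * (g t : R)].
  have mP : measurable P.
    have mg : measurable_fun setT (fun t => s * (g t : R)).
      by apply: measurable_funM => //; exact: L1_repr_measurable.
    have := mg measurableT `[M + 1, +oo[%classic (measurable_itv _).
    rewrite setTI; congr (measurable _); apply/seteqP.
    by split => t /=; rewrite in_itv/= andbT.
  exists P; split => //; last first.
    by move=> t /= /negP; rewrite -leNgt.
  have H1 : 0 <= lint P (s *: g - (M + 1) *: ind mu setT).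
    apply: ge0_lint => //.
    apply: filterS3 (L1_repr_linear (- (M + 1)) (ind mu setT) (s *: g))
      (L1_reprZ s g) (indE finmu measurableT) => t.
    rewrite scaleNr addrC => /= -> -> ->.
    by rewrite indicT scaleNr -[_ *: 1]/(_ * 1) mulr1 addrC subr_ge0.
  rewrite lintB// !lintZ// lint_ind// setTI -gE// in H1.
  have H2 := Hind P mP.
  have H3 : s * psi (ind mu P) <= `|psi (ind mu P)|.
    by rewrite (le_trans (ler_norm _))// normrM s1 mul1r.
  apply/eqP; rewrite -[mu P]fineK ?finmu// eqe eq_le fine_ge0// andbT.
  by move: H1 H2 H3; lra.
apply: filterS2 (null 1 (normr1 _)) (null (-1) (normrN1 _)) => t.
by rewrite mul1r mulN1r ltr_norml => -> H; rewrite ltrNl H.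
Qed.

(** Slice the range of the bounded density of psi into intervals of length
    below e; replacing the density by the lower end of each slice changes psi by
    at most e in the dual norm. *)
Lemma dual_step_approx (psi : dual (L1 mu R^o)) (e : R) : 0 < e ->
  exists n (c : 'I_n -> R) (E : 'I_n -> set T),
    (forall i, measurable (E i)) /\
    forall f, `|(psi f : R) - \sum_(i < n) c i * lint (E i) f| <= e * `|f|.
Proof.
move=> e0; have [M M0 HM] := bop_bound psi.
have [g gM psig] := dual_density M0 HM.
have [L L0 gL] : exists2 L : R, 0 < L & {ae mu, forall t, `|g t : R| < L}.
  by exists (M + 1) => //; rewrite ltr_wpDl.
have [n [eta [eta0 etae neta]]] : exists n (eta : R),
    [/\ 0 < eta, eta < e & n%:R * eta = 2 * L].
  have L2 : 0 < 2 * L by rewrite mulr_gt0.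
  exists (Num.truncn (2 * L / e)).+1, (2 * L / (Num.truncn (2 * L / e)).+1%:R).
  split; [by rewrite divr_gt0| |by rewrite mulrC divfK].
  have /andP[_] := truncn_itv (ltW (divr_gt0 L2 e0)).
  by rewrite !ltr_pdivrMr// [e * _]mulrC.
pose c (i : 'I_n) := - L + i%:R * eta.
pose E (i : 'I_n) := [set t | c i <= (g t : R) < c i + eta].
have mE i : measurable (E i).
  have mg : measurable_fun setT (g : T -> R) by exact: L1_repr_measurable.
  have := mg measurableT `[c i, c i + eta[%classic (measurable_itv _).
  by rewrite setTI.
have tE : trivIset setT E.
  move=> i j _ _ [t []]; rewrite /E /c /= => /andP[i1 i2] /andP[j1 j2].
  have le k l : k%:R * eta < l%:R * eta + eta -> (k <= l)%N.
    by rewrite -{3}(mul1r eta) -mulrDl natr1 ltr_pM2r// ltr_nat.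
  by apply/val_inj/eqP; rewrite eqn_leq; apply/andP; split; apply: le; lra.
exists n, c, E; split => //.
have near_g : {ae mu, forall t, `|(g - step mu c E : L1 mu R^o) t| <= eta}.
  apply: filterS3 gL (stepE finmu c mE) (L1_repr_linear (-1) (step mu c E)
    g) => t.
  rewrite scaleN1r addrC => /ltr_normlP[g1 g2] + ->; move=> ->.
  have q0 : 0 <= (g t + L) / eta by rewrite divr_ge0//; lra.
  have /andP[k1 k2] := truncn_itv q0.
  rewrite ler_pdivlMr// in k1; rewrite ltr_pdivrMr// in k2.
  have kn : (Num.truncn ((g t + L) / eta) < n)%N.
    rewrite -(ltr_nat R) -(ltr_pM2r eta0) (le_lt_trans k1)//.
    by rewrite neta; lra.
  rewrite (step_disjointE c (i := Ordinal kn) tE); last first.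
    by rewrite /E /c /=; rewrite -natr1 in k2; lra.
  rewrite scaleN1r addrC ler_norml /c /=; rewrite -natr1 in k2.
  by apply/andP; split; lra.
apply: (@le_norm_ind _ _ _ mu finmu _ (M + \sum_(i < n) `|c i|) e) => //.
- exact: ltW.
- move=> a f h; rewrite linearP; under eq_bigr do rewrite lintD// lintZ//
  mulrDr mulrCA.
  by rewrite big_split/= -mulr_sumr; rewrite /GRing.scale/=; ring.
- move=> f; rewrite mulrDl; apply: le_trans (ler_normB _ _) (lerD (HM f) _).
  apply: le_trans (ler_norm_sum _ _ _) _; rewrite mulr_suml ler_sum// => i _.
  by rewrite normrM ler_wpM2l// lint_le_norm.
move=> D mD; have -> : psi (ind mu D) - \sum_(i < n) c i * lint (E i)
  (ind mu D) =
    lint D (g - step mu c E) :> R.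
  rewrite lintB// psig// /step lint_sum//; congr (_ - _).
  by apply: eq_bigr => i _; rewrite lintZ// lint_indC.
rewrite (le_trans (lint_mass _ mD))// (le_trans (mass_le_cst mD (ltW eta0)
  near_g))//.
by rewrite ler_wpM2r// ?fine_ge0// ltW.
Qed.

End dual_L1.

(** * Weak compactness in L1 *)

Section weak_compactness.

Lemma ultra_cvg_bounded (I : Type) (R : realType) (F : set_system I)
    (phi : I -> R) (M : R) : UltraFilter F ->
  F [set i | `|phi i| <= M] -> exists l : R, phi i @[i --> F] --> l.
Proof.
move=> FU FM.
have FMM : F (phi @^-1` `[- M, M]%classic).
  by apply: filterS FM => i; rewrite /= in_itv/= ler_norml.
have [l [_ cl]] := @segment_compact R (- M) M (phi @ F) _ FMM.
exists l => A lA; have [//|FnA] := in_ultra_setVsetC (phi @^-1` A) FU.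
by have [x [nAx /nAx]] := cl (~` A) A FnA lA.
Qed.

Lemma cvg_norm_le (I : Type) (R : realType) (F : set_system I) (phi : I -> R)
    (M l : R) : ProperFilter F -> phi i @[i --> F] --> l ->
  F [set i | `|phi i| <= M] -> `|l| <= M.
Proof.
move=> FF /cvgrPdist_lt phil FM; apply/ler_addgt0Pr => e e0.
have [i [/= d1 d2]] := filter_ex (filterI (phil e e0) FM).
by have := ler_normD (l - phi i) (phi i); rewrite subrK; lra.
Qed.

Context d (T : measurableType d) (R : realType).
Variables (mu : {measure set T -> \bar R}) (finmu : fin_num_fun mu).
Local Notation L1R := (L1 mu R^o).
Implicit Types (f g h : L1R) (D E : set T).

Lemma cvg_weak_lint (F : set_system L1R) (M : R) h : Filter F ->
  F [set f | `|f| <= M] ->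
  (forall E, measurable E -> lint E f @[f --> F] --> lint E h) ->
  F --> (h : weak L1R).
Proof.
move=> FF FM Fh; apply/cvg_weakP => psi; apply/cvgrPdist_lt => e e0.
pose K := `|M| + `|h| + 1.
have K0 : 0 < K by rewrite ltr_wpDl// addr_ge0.
have e2 : 0 < e / 2 by rewrite divr_gt0.
have [n [c [E [mE apx]]]] := dual_step_approx finmu psi (divr_gt0 e2 K0).
have : \sum_(i < n) c i * lint (E i) f @[f --> F] -->
    (\sum_(i < n) c i * lint (E i) h : R).
  apply: cvg_big => [|i _]; first exact: add_continuous.
  by apply: cvgMr; exact: Fh.
move=> /cvgrPdist_lt/(_ _ e2) near_sum.
apply: filterS2 near_sum FM => f /= sf fM.
have := apx f; have := apx h.
set s1 := \sum_(i < n) _ in sf *; set s2 := \sum_(i < n) _ in sf *.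
set q := e / 2 / K => ah af.
have qK : q * K = e / 2 by rewrite /q divfK// gt_eqF.
have : q * (`|h| + `|f|) <= q * K.
  rewrite ler_wpM2l ?ltW ?divr_gt0// /K; have := ler_norm M; lra.
rewrite qK mulrDr => qhf.
have := ler_distD s1 (psi h : R) (psi f).
have := ler_distD s2 s1 (psi f : R).
rewrite (distrC s2 (psi f : R)); lra.
Qed.

(** The signed integrals, instead of those of absolute values, and the weak
    inequalities make this form of uniform integrability closed under
    convergence of the integrals; M bounds the norm up to a factor 2. *)
Definition small_integrals (M : R) (del : R -> R) : set L1R :=
  [set f | forall E, measurable E -> `|lint E f| <= M /\
    forall e, 0 < e -> (mu E < (del e)%:E)%E -> `|lint E f| <= e].

Lemma small_integrals_norm M del f : small_integrals M del f -> `|f| <= 2 * M.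
Proof. by move=> H; apply: norm_le_lint => E mE; have [] := H E mE. Qed.

Lemma small_integrals_lim M del (F : set_system L1R) h : ProperFilter F ->
  F (small_integrals M del) ->
  (forall E, measurable E -> lint E f @[f --> F] --> lint E h) ->
  small_integrals M del h.
Proof.
move=> FF FK Fh E mE; split => [|e e0 Ee]; apply: (cvg_norm_le FF (Fh E mE)).
  by apply: filterS FK => f /(_ E mE)[].
by apply: filterS FK => f /(_ E mE)[_]; exact.
Qed.

(** The limits of the integrals along an ultrafilter form an absolutely
    continuous set function, whose density is the limit. *)
Lemma small_integrals_cvg M del (F : set_system L1R) : UltraFilter F ->
  (forall e, 0 < e -> 0 < del e) -> F (small_integrals M del) ->
  exists h, forall E, measurable E -> lint E f @[f --> F] --> lint E h.
Proof.
move=> FU del0 FK.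
have /choice[nu nuE] : forall E, exists l : R,
    measurable E -> lint E f @[f --> F] --> l.
  move=> E; have [mE|nmE] := pselect (measurable E); last by exists 0.
  have [|l El] := @ultra_cvg_bounded _ _ F (lint E) M FU _; last by exists l.
  by apply: filterS FK => f /(_ E mE)[].
have [E E' mE mE' EE'|e e0|h hE] := @radon_nikodym_ac _ _ _ mu finmu nu.
- have H : lint (E `|` E') f @[f --> F] --> nu E + nu E'.
    under eq_fun do rewrite lintU//.
    by apply: cvgD; exact: nuE.
  exact: cvg_unique (nuE _ (measurableU _ _ mE mE')) H.
- exists (del e); first exact: del0.
  move=> E mE Ee; apply: (cvg_norm_le _ (nuE _ mE)).
  by apply: filterS FK => f /(_ E mE)[_]; exact.
by exists h => E mE; rewrite -hE//; exact: nuE.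
Qed.

Lemma lint_weak_continuous (F : set_system L1R) h E : Filter F ->
  measurable E -> F --> (h : weak L1R) -> lint E f @[f --> F] --> lint E h.
Proof.
move=> FF mE /cvg_weakP Fh.
have bnd (f : L1R) : `|lint E f : R^o| <= 1 * `|f|.
  by rewrite mul1r; exact: lint_le_norm.
exact: (Fh (bop_of (lint_linear mE) bnd)).
Qed.

Lemma small_integrals_precompact M del (K : set L1R) :
  (forall e, 0 < e -> 0 < del e) -> K `<=` small_integrals M del ->
  @precompact (weak L1R) K.
Proof.
move=> del0 Ksub; exists (small_integrals M del : set (weak L1R)) => //; split.
  rewrite compact_ultra => F FU FK.
  have [h Fh] := small_integrals_cvg FU del0 FK.
  exists h; split; first exact: (small_integrals_lim _ FK Fh).
  apply: (@cvg_weak_lint _ (2 * M)) => //.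
  by apply: filterS FK => f; exact: small_integrals_norm.
move=> h; rewrite closureEcvg => -[F FF [Fh FK]].
apply: (small_integrals_lim FF) => [|E mE]; last exact: lint_weak_continuous.
by apply: FK => f.
Qed.

Lemma uniformly_integrable_small (K : set L1R) (M : R) :
  uniformly_integrable K -> (forall f, K f -> `|f| <= M) ->
  exists2 del, (forall e, 0 < e -> 0 < del e) & K `<=` small_integrals M del.
Proof.
move=> [_ ui] HM.
have /choice[del Hdel] : forall e : R, exists r : R, 0 < e -> 0 < r /\
    forall f E, K f -> measurable E -> (mu E < r%:E)%E -> mass E f < e.
  move=> e; have [e0|_] := ltP 0 e; last by exists 0.
  by have [r r0 Hr] := ui e e0; exists r.
exists del => [e /Hdel[]//|f Kf E mE]; split.
  by rewrite (le_trans (lint_le_norm _ mE))// HM.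
move=> e /Hdel[_ H] Ee.
by rewrite (le_trans (lint_mass _ mE))// ltW// H.
Qed.

End weak_compactness.

(** * Subsequences along a countable family, and the Borel sets of the line *)

Lemma fmap_ultra (I J : Type) (f : I -> J) (F : set_system I) :
  UltraFilter F -> UltraFilter (f @ F).
Proof.
move=> FU; split => [|G GF FG]; first exact: fmap_proper_filter.
apply/seteqP; split => // A GA; have [//|FA] :=
  in_ultra_setVsetC (f @^-1` A) FU.
by have [x []] := filter_ex (filterI GA (FG (~` A) FA)).
Qed.

(** Instead of a diagonal argument: finitely many of the sequences are close to
    their limits on a common set of the filter, and such a set is unbounded, so
    one index k n can serve the first n sequences at once. *)
Lemma subsequence_countable (R : realType) (I : countType) (F : set_system nat)
    (a : I -> nat -> R) (c : I -> R) : ProperFilter F -> \oo `<=` F ->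
  (forall i, a i n @[n --> F] --> c i) ->
  exists2 k : nat -> nat, {homo k : m n / (m < n)%N} &
    forall i, a i (k n) @[n --> \oo] --> c i.
Proof.
move=> FF ooF Fa.
have next n m : exists l, (m < l)%N /\
    forall i : I, (pickle i <= n)%N -> `|c i - a i l| < n.+1%:R^-1.
  have H : F [set l | forall j : 'I_n.+1, forall i : I, pickle i = j ->
      `|c i - a i l| < n.+1%:R^-1].
    apply: (@filter_forall _ _ (fun (j : 'I_n.+1) l =>
      forall i : I, pickle i = j ->
      `|c i - a i l| < n.+1%:R^-1)) => j.
    have [[i ij]|none] := pselect (exists i : I, pickle i = j); last first.
      by apply: filterS filterT => l _ i ij; exfalso; apply: none; exists i.
    have /cvgrPdist_lt/(_ n.+1%:R^-1) := Fa i.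
    rewrite invr_gt0 => /(_ (ltr0Sn _ _)); apply: filterS => l Hl i' i'j.
    by have -> : i' = i by apply: (pcan_inj pickleK); rewrite i'j ij.
  have [l [Hl ml]] := filter_ex (filterI H (ooF _ (nbhs_infty_gt m))).
  exists l; split => // i; rewrite -ltnS => il.
  exact: (Hl (Ordinal il)).
have /choice[g gP] : forall p : nat * nat, exists l, (p.2 < l)%N /\
    forall i : I, (pickle i <= p.1)%N -> `|c i - a i l| < p.1.+1%:R^-1.
  by move=> [n m]; exact: next.
pose k := fix k n := if n is n'.+1 then g (n, k n') else g (0, 0)%N.
have kapx n i : (pickle i <= n)%N -> `|c i - a i (k n)| < n.+1%:R^-1.
  by case: n => [|n]; [exact: (gP (0, 0)%N).2 i|exact: (gP (n.+1, k n)).2 i].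
exists k.
  by apply: homo_ltn => [|n]; [exact: ltn_trans|exact: (gP (n.+1, k n)).1].
move=> i; apply/cvgrPdist_lt => e e0; near=> n.
apply: (@lt_trans _ _ n.+1%:R^-1).
  by apply: kapx; near: n; exact: nbhs_infty_ge.
by near: n; exact: near_infty_natSinv_lt (PosNum e0).
Unshelve. all: by end_near. Qed.

Section borel.
Context (R : realType).
Variables (mu : {measure set (measurableTypeR R) -> \bar R}).
Hypothesis finmu : fin_num_fun mu.

Definition rat_ray (q : rat) : set (measurableTypeR R) :=
  `]-oo, ratr q[%classic.

Lemma measurable_rat_ray q : measurable (rat_ray q).
Proof. exact: measurable_itv. Qed.

Lemma sub_rat_ray p q : p <= q -> rat_ray p `<=` rat_ray q.
Proof.
move=> pq t; rewrite /rat_ray/= !in_itv/= => /lt_le_trans; apply.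
by rewrite ler_rat.
Qed.

(** The rational rays form a countable pi-system generating the Borel sets;
    inner approximation replaces closure under countable disjoint unions, and
    also passes from rational to real endpoints. *)
Lemma borel_induction (P : set_system (measurableTypeR R)) :
  P setT -> (forall q, P (rat_ray q)) ->
  (forall E, measurable E -> P E -> P (~` E)) ->
  (forall E F, measurable E -> measurable F -> [disjoint E & F] ->
    P E -> P F -> P (E `|` F)) ->
  (forall E, measurable E -> (forall e : R, 0 < e -> exists F,
    [/\ measurable F, F `<=` E, (mu (E `\` F) < e%:E)%E & P F]) -> P E) ->
  forall E, measurable E -> P E.
Proof.
move=> PT Pray PC PU Papx.
have Pcup (F : nat -> set (measurableTypeR R)) : (forall n, measurable (F n)) ->
    (forall n, exists2 N, (n <= N)%N & P (\big[setU/set0]_(0 <= i < N) F i)) ->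
    P (\bigcup_n F n).
  move=> mF PF; apply: Papx; first exact: bigcup_measurable.
  move=> e e0; have [m _ Hm] := cvg_tail0 finmu mF e0.
  have [N mN PN] := PF m; exists (\big[setU/set0]_(0 <= i < N) F i);
    split => //.
  - exact: bigsetU_measurable.
  - by rewrite big_mkord -bigcup_mkord => t [i _ Fit]; exists i.
  - exact: Hm.
have P0 : P set0 by rewrite -setCT; exact: PC.
have mG : @measurable _ (measurableTypeR R) = <<s @RGenInftyO.G R >>.
  exact: RGenInftyO.measurableE.
move=> E mE; have : <<s @RGenInftyO.G R >> E by rewrite -mG.
move: E {mE}; apply: (dynkin_induction mG) => //.
- move=> _ _ [x ->] [y ->]; exists (Num.min x y).
  apply/seteqP; split => t /=; rewrite !in_itv/= lt_min.
    by move=> [-> ->].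
  by move=> /andP.
- move=> _ [x ->].
  have /choice[q qx] : forall n : nat, exists q : rat,
      x - n.+1%:R^-1 < ratr q < x.
    move=> n; have : x - n.+1%:R^-1 < x by rewrite gtrBl invr_gt0.
    by move=> /rat_in_itvoo[q]; rewrite in_itv/=; exists q.
  have -> : `]-oo, x[%classic = \bigcup_n rat_ray (q n).
    apply/seteqP; split => t /=; rewrite in_itv/=; last first.
      move=> [n _]; rewrite /rat_ray/= in_itv/= => tq.
      by rewrite (lt_trans tq)//; case/andP: (qx n).
    rewrite -subr_gt0 => xt.
    have [n _ /(_ n (leqnn _)) nx] := near_infty_natSinv_lt (PosNum xt).
    exists n => //; rewrite /rat_ray/= in_itv/=.
    have {}nx : n.+1%:R^-1 < x - t by [].
    by case/andP: (qx n) => qn _; apply: lt_trans qn; rewrite ltrBrDl -ltrBrDr.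
  apply: Pcup => [n|n]; first exact: measurable_rat_ray.
  exists n.+1; first exact: leqnSn.
  suff [r ->] : exists r, \big[setU/set0]_(0 <=
    i < n.+1) rat_ray (q i) = rat_ray r.
    exact: Pray.
  elim: n => [|n [r rE]]; first by exists (q 0%N); rewrite big_nat1.
  rewrite big_nat_recr//= rE; have [rq|/ltW qr] := leP r (q n.+1).
    by exists (q n.+1); rewrite setUidr//; exact: sub_rat_ray.
  by exists r; rewrite setUidl//; exact: sub_rat_ray.
- move=> F mF tF PF; apply: Pcup => // n; exists n => //.
  elim: n => [|n IH]; first by rewrite big_geq.
  rewrite big_nat_recr//=; apply: PU => //; first exact: bigsetU_measurable.
  apply/disj_setPS; rewrite big_mkord -bigcup_mkord => t [[i /= ik Fit] Fnt].
  have ii : i = n by apply: tF => //; exists t.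
  by move: ik; rewrite ii ltnn.
Qed.

End borel.

(** * Sequential compactness in the weak operator topology *)

Section wot_sequence.
Context (R : realType).
Local Notation T := (measurableTypeR R).
Variables (mu : {measure set T -> \bar R}) (finmu : fin_num_fun mu).
Local Notation L1R := (L1 mu R^o).

Section limit.
Variables (S : nat -> bop L1R L1R) (S0 : bop L1R L1R) (C : R) (k : nat -> nat).
Variable del : L1R -> R -> R.
Hypothesis C0 : 0 <= C.
Hypothesis del0 : forall f e, 0 < e -> 0 < del f e.
Hypothesis Ssmall : forall n f, small_integrals (C * `|f|) (del f) (S n f).
Hypothesis S0small : forall f, small_integrals (C * `|f|) (del f) (S0 f).

(* [conv] is the convergence to be established; the sets [test] are the
   countable family on which it is given. *)
Let conv f E := lint E (S (k n) f) @[n --> \oo] --> lint E (S0 f).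
Let test (i : option rat) : set T := if i is Some q then rat_ray q else setT.
Hypothesis conv_test : forall i j, conv (ind mu (test i)) (test j).

(** Here f is fixed and the set of integration varies: approximating it changes
    all the integrals by little because of uniform integrability. *)
Lemma conv_of_test f : (forall j, conv f (test j)) ->
  forall E, measurable E -> conv f E.
Proof.
move=> ft; apply: (borel_induction finmu).
- exact: (ft None).
- by move=> q; exact: (ft (Some q)).
- move=> E mE fE; have mCE := measurableC mE.
  have EC (g : L1R) : lint (~` E) g = lint setT g - lint E g.
    rewrite -(setUv E) lintU//; last by apply/disj_setPS => t [].
    by rewrite addrAC subrr add0r.
  rewrite /conv EC; under eq_fun do rewrite EC.
  by apply: cvgB => //; exact: (ft None).
- move=> E F mE mF EF fE fF; rewrite /conv lintU//.
  by under eq_fun do rewrite lintU//; exact: cvgD.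
- move=> E mE apx; apply/cvgrPdist_lt => e e0.
  have e3 : 0 < e / 3 by rewrite divr_gt0.
  have [F [mF FE muEF fF]] := apx _ (del0 f e3).
  have mEF : measurable (E `\` F) by exact: measurableD.
  have EF (g : L1R) : lint E g = lint F g + lint (E `\` F) g.
    by rewrite -lintU ?setDUK//; apply/disj_setPS => t [? []].
  have small n := (Ssmall (k n) f mEF).2 _ e3 muEF.
  have small0 := (S0small f mEF).2 _ e3 muEF.
  move/cvgrPdist_lt : fF => /(_ _ e3); apply: filterS => n /= Fn.
  rewrite !EF; have := small n; move: small0 Fn.
  rewrite !ler_norml !ltr_norml; lra.
Qed.

(** Here the argument of the operators varies, and uniform boundedness is what
    controls the error. *)
Lemma conv_approx f :
  (forall e : R, 0 < e -> exists2 g : L1R, `|f - g| < e &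
    forall E, measurable E -> conv g E) ->
  forall E, measurable E -> conv f E.
Proof.
move=> apx E mE; apply/cvgrPdist_lt => e e0.
have e3 : 0 < e / 3 / (C + 1) by rewrite !divr_gt0// ltr_wpDl.
have [g fg gE] := apx _ e3.
have Cfg : C * `|f - g| <= e / 3.
  move: fg; rewrite ltr_pdivlMr ?ltr_wpDl//.
  by have := normr_ge0 (f - g); lra.
have small n := le_trans (Ssmall (k n) (f - g) mE).1 Cfg.
have small0 := le_trans (S0small (f - g) mE).1 Cfg.
have e3' : 0 < e / 3 by rewrite divr_gt0.
move/cvgrPdist_lt : (gE E mE) => /(_ _ e3'); apply: filterS => n /= gn.
have := small n; move: small0 gn.
rewrite !linearB !lintB//= !ler_norml !ltr_norml; lra.
Qed.

Lemma conv_step n (c : 'I_n -> R) (D : 'I_n -> set T) E :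
  measurable E -> (forall i, conv (ind mu (D i)) E) -> conv (step mu c D) E.
Proof.
move=> mE DE; rewrite /conv.
have SE (S' : bop L1R L1R) : lint E (S' (step mu c D)) =
    \sum_(i < n) c i * lint E (S' (ind mu (D i))).
  by rewrite /step linear_sum lint_sum//; apply: eq_bigr => i _;
    rewrite linearZ lintZ.
rewrite SE; under eq_fun do rewrite SE.
apply: cvg_big => [|i _]; first exact: add_continuous.
by apply: cvgMr; exact: DE.
Qed.

Lemma conv_ind D : measurable D -> forall E, measurable E -> conv (ind mu D) E.
Proof.
move: D; apply: (borel_induction finmu).
- apply: conv_of_test => j. exact: (@conv_test None j).
- by move=> q; apply: conv_of_test => j; exact: (@conv_test (Some q) j).
- move=> D mD DE E mE; have mCD := measurableC mD.
  have -> : ind mu (~` D) = ind mu setT - ind mu D.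
    rewrite -(setUv D) indU//; last by apply/disj_setPS => t [].
    by rewrite addrAC subrr add0r.
  rewrite /conv linearB lintB//; under eq_fun do rewrite linearB lintB//.
  apply: cvgB; last exact: DE.
  by apply: conv_of_test => // j; exact: (@conv_test None j).
- move=> D D' mD mD' DD' DE DE' E mE; rewrite indU// /conv linearD lintD//.
  by under eq_fun do rewrite linearD lintD//; apply: cvgD;
    [exact: DE|exact: DE'].
- move=> D mD apx; apply: conv_approx => e e0.
  have [F [mF FD muDF FE]] := apx e e0; exists (ind mu F) => //.
  have mDF : measurable (D `\` F) by exact: measurableD.
  have -> : ind mu D = ind mu F + ind mu (D `\` F).
    by rewrite -indU ?setDUK//; apply/disj_setPS => t [? []].
  rewrite addrAC subrr add0r norm_ind//.
  by rewrite -lte_fin fineK// finmu.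
Qed.

Lemma conv_all f E : measurable E -> conv f E.
Proof.
move: E; apply: conv_approx => e e0.
have [n [c [D [mD _ fD]]]] := step_dense finmu f e0.
by exists (step mu c D) => // E mE; apply: conv_step => // i; exact: conv_ind.
Qed.

Lemma cvg_wot_of_test : S (k n) @[n --> \oo] --> (S0 : wot L1R L1R).
Proof.
apply/cvg_wotP => psi f.
have : S (k n) f @[n --> \oo] --> (S0 f : weak L1R).
  apply: (cvg_weak_lint finmu (M := 2 * (C * `|f|))).
    by exists 0%N => // n _ /=; exact: small_integrals_norm (Ssmall _ f).
  by move=> E mE; exact: conv_all.
by move=> /cvg_weakP/(_ psi).
Qed.

End limit.

(** The limit operator is found first, along a free ultrafilter, so that the
    subsequence only has to converge to a known limit. *)
Lemma wot_subsequence (S : nat -> bop L1R L1R) (C : R) : 0 <= C ->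
  (forall f, exists2 del, (forall e, 0 < e -> 0 < del e) &
    forall n, small_integrals (C * `|f|) del (S n f)) ->
  exists k : nat -> nat, {homo k : m n / (m < n)%N} /\
    exists S0 : bop L1R L1R, S (k n) @[n --> \oo] --> (S0 : wot L1R L1R).
Proof.
move=> C0 H.
have /choice[del Hdel] : forall f, exists del : R -> R,
    (forall e, 0 < e -> 0 < del e) /\
    forall n, small_integrals (C * `|f|) del (S n f).
  by move=> f; have [del d0 Hd] := H f; exists del.
have ooF : ProperFilter (\oo : set_system nat) by exact: _.
have [U [UU ooU]] := ultraFilterLemma ooF.
have ultraS f : UltraFilter ((fun n => S n f) @ U) by exact: fmap_ultra.
have SK f : ((fun n => S n f) @ U) (small_integrals (C * `|f|) (del f)).
  by apply: (@filterS _ U _ setT) => [n _|]; [exact: (Hdel f).2|exact: filterT].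
have /choice[s sE] : forall f : L1R, exists h : L1R, forall E, measurable E ->
    lint E (S n f) @[n --> U] --> lint E h.
  by move=> f; exact: (small_integrals_cvg finmu (ultraS f) (Hdel f).1 (SK f)).
have ssmall f : small_integrals (C * `|f|) (del f) (s f).
  exact: (small_integrals_lim _ (SK f) (sE f)).
have slin : linear s.
  move=> a f g; apply: lint_inj => E mE.
  suff H2 : lint E (S n (a *: f + g)) @[n --> U] --> lint E (a *: s f + s g).
    exact: cvg_unique (sE _ E mE) H2.
  rewrite [X in _ --> X](lint_linear mE).
  under eq_fun do rewrite linearP [lint _ _](lint_linear mE).
  by apply: cvgD; [apply: cvgMr|]; exact: sE.
have sbnd f : `|s f| <= 2 * C * `|f|.
  by rewrite -mulrA; exact: small_integrals_norm (ssmall f).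
pose test (i : option rat) : set T := if i is Some q then rat_ray q else setT.
have mtest i : measurable (test i).
  by case: i => [q|]; [exact: measurable_rat_ray|exact: measurableT].
have [k kmono kE] := @subsequence_countable R (option rat * option rat)%type U
  (fun p n => lint (test p.2) (S n (ind mu (test p.1))))
  (fun p => lint (test p.2) (s (ind mu (test p.1)))) _ ooU
  (fun p => sE _ _ (mtest p.2)).
exists k; split => //; exists (bop_of slin sbnd).
apply: (@cvg_wot_of_test S (bop_of slin sbnd) C k del) => //.
- by move=> f e; exact: (Hdel f).1.
- by move=> n f; exact: (Hdel f).2.
- by move=> i j; exact: (kE (i, j)).
Qed.

End wot_sequence.

(** * Components of an operator as compositions with functionals *)

Section dual_norm.
Context (R : realType) (V : normedModType R).

Lemma opnormP (phi : dual V) (v : V) : `|phi v| <= opnorm phi * `|v|.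
Proof.
have [M M0 HM] := bop_bound phi.
have [->|v0] := eqVneq v 0; first by rewrite linear0 !normr0 mulr0.
have nv0 : 0 < `|v| by rewrite normr_gt0.
rewrite -ler_pdivrMr// mulrC.
have -> : `|v|^-1 * `|phi v| = `|phi (`|v|^-1 *: v)|.
  by rewrite linearZ normrM ger0_norm// invr_ge0.
apply: ub_le_sup; last first.
  by exists (`|v|^-1 *: v) => //=; rewrite normrZ ger0_norm ?invr_ge0//
    mulVf ?gt_eqF.
exists M => _ [w /= w1 <-]; rewrite (le_trans (HM w))//.
by rewrite ler_piMr.
Qed.

Lemma bounded_dual_setP (A : set (dual V)) : bounded_dual_set A ->
  exists2 M : R, 0 < M & forall phi v, A phi -> `|phi v| <= M * `|v|.
Proof.
move=> [M HM]; exists (`|M| + 1); first by rewrite ltr_wpDl.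
move=> phi v Aphi; rewrite (le_trans (opnormP _ _))// ler_wpM2r//.
by rewrite (le_trans (HM _ Aphi))// (le_trans (ler_norm _))// lerDl.
Qed.

End dual_norm.

Section components.
Context d (T : measurableType d) (R : realType).
Variables (mu : {measure set T -> \bar R}) (X : normedModType R).
Variable S : bop (L1 mu X) (L1 mu X).

Lemma dual_compE (phi : dual X) (u : L1 mu X) :
  {ae mu, forall t, dual_comp phi u t = phi (u t)}.
Proof. exact: L1_classE. Qed.

Lemma mass_dual_comp (phi : dual X) (M : R) (u : L1 mu X) E :
  measurable E -> (forall v, `|phi v| <= M * `|v|) ->
  mass E (dual_comp phi u) <= M * mass E u.
Proof.
move=> mE HM; rewrite -RintegralZl//; last exact: L1_norm_integrable.
rewrite /mass /Rintegral; apply: fine_le.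
- by apply: integrable_fin_num => //; exact: L1_norm_integrable.
- apply: integrable_fin_num => //.
  have := integrableZl mE M (L1_norm_integrable u mE).
  by apply: eq_integrable => // t _ /=; rewrite EFinM.
apply: ae_ge0_le_integral => //.
- exact: (measurable_funTS (L1fun_norm_measurable _)).
- by move=> t _; rewrite lee_fin (le_trans _ (HM _)).
- under eq_fun do rewrite EFinM; apply: measurable_funeM.
  exact: (measurable_funTS (L1fun_norm_measurable _)).
by apply: filterS (dual_compE phi u) => t /= -> _; rewrite lee_fin HM.
Qed.

Lemma lint_pairing E (f : L1 mu R^o) : measurable E ->
  lint E f = pairing \1_E f.
Proof.
move=> mE; rewrite /lint Rintegral_mkcond; apply: eq_Rintegral => t _.
by rewrite patchE indicE; case: ifP => _; rewrite ?mul1r ?mul0r.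
Qed.

(** Both sides have the same integral over every measurable set: pair the
    component with indicators. *)
Lemma component_dual_comp (phi : dual X) (x : X) (f : L1 mu R^o) :
  component S phi x f = dual_comp phi (S (tensor f x)).
Proof.
apply: lint_inj => E mE; rewrite !lint_pairing//.
rewrite (componentP S phi x f (indic_Linfty mu mE)).
have mI : measurable_fun setT (\1_E : T -> R) by exact: measurable_indic.
rewrite /tensor_pairing /pairing /Rintegral; congr fine.
apply: ae_eq_integral => //.
- apply/measurable_EFinP/measurable_funM => //; exact: dual_repr_measurable.
- apply/measurable_EFinP/measurable_funM => //; exact: L1_repr_measurable.
by apply: filterS (dual_compE phi (S (tensor f x))) => t /= ->.
Qed.

Lemma tensor_linear_r (f : L1 mu R^o) : linear (tensor f : X -> L1 mu X).
Proof.
move=> a x y; apply/L1_eq.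
apply: filterS3 (L1_classE (L1Fun (bochner_tensor f (a *: x + y))))
  (L1_repr_linear a (tensor f x) (tensor f y))
  (filterI (L1_classE (L1Fun (bochner_tensor f x)))
    (L1_classE (L1Fun (bochner_tensor f y)))).
move=> t /= -> -> [-> ->].
by rewrite scalerDr !scalerA mulrC.
Qed.

Lemma tensor_bop (f : L1 mu R^o) :
  exists u : bop X (L1 mu X), forall x, u x = S (tensor f x).
Proof.
have [M M0 HM] := bop_bound S.
have lin : linear (fun x => S (tensor f x)).
  by move=> a x y; rewrite tensor_linear_r linearP.
have bnd x : `|S (tensor f x)| <= M * `|f| * `|x|.
  by rewrite (le_trans (HM _))// -mulrA ler_wpM2l// mulrC norm_tensor.
by exists (bop_of lin bnd).
Qed.

Variables (A : set (dual X)) (B : set X).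
Hypotheses (hA : bounded_dual_set A) (hB : bounded_set B).

Lemma component_bound : exists2 C : R, 0 <= C &
  forall phi x f, A phi -> B x -> `|component S phi x f| <= C * `|f|.
Proof.
have [M M0 HM] := bounded_dual_setP hA; have [K K0 HK] := bounded_setP hB.
have [N N0 HN] := bop_bound S.
exists (M * (N * K)); first by rewrite !mulr_ge0// ltW.
move=> phi x f Aphi Bx; rewrite component_dual_comp.
apply: le_trans (norm_dual_comp _ (ltW M0) (fun v => HM phi v Aphi)) _.
rewrite -!mulrA; apply: ler_wpM2l; first exact: ltW.
apply: le_trans (HN _) _; apply: ler_wpM2l => //.
by apply: le_trans (norm_tensor _ _) _; rewrite ler_wpM2r// HK.
Qed.

(** Composing with phi costs a factor bounded on A, after which
    [uniform_mass] applies to x |-> S (tensor f x). *)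
Lemma component_uniformly_integrable (f : L1 mu R^o) :
  (~ exists x : nat -> X, (forall n, B (x n)) /\ equiv_ell1 x) ->
  uniformly_integrable [set component S p.1 p.2 f | p in A `*` B].
Proof.
move=> noell1; have [C C0 HC] := component_bound; split.
  exists (C * `|f|); split; first exact: num_real.
  by move=> M ltM _ [[phi x] [/= Aphi Bx] <-];
    rewrite (le_trans _ (ltW ltM))// HC.
move=> e e0; have [M M0 HM] := bounded_dual_setP hA.
have [u uE] := tensor_bop f.
have [del del0 Hdel] := uniform_mass u hB noell1 (divr_gt0 e0 M0).
exists del => // _ E [[phi x] [/= Aphi Bx] <-] mE Edel.
rewrite -[ltLHS]/(mass E (component S phi x f)) component_dual_comp.
apply: le_lt_trans (mass_dual_comp _ mE (fun v => HM phi v Aphi)) _.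
by rewrite -uE mulrC -ltr_pdivlMr//; exact: Hdel.
Qed.

End components.

(** * The components of an operator on L1([0, 1); X) *)

Lemma lebesgue01_finite (R : realType) : fin_num_fun (lebesgue01 R).
Proof.
apply: lty_fin_num_fun; rewrite /lebesgue01 /= /mrestr setTI.
by rewrite lebesgue_measure_itv/= lte_fin ltr01 ltry.
Qed.

Theorem theorem3p2 (R : realType) (X : completeNormedModType R)
    (T : bop (L1 (lebesgue01 R) X) (L1 (lebesgue01 R) X))
    (A : set (dual X)) (B : set X)
    (hA : bounded_dual_set A) (hB : bounded_set B)
    (hl1 : ~ exists x : nat -> X, (forall n, B (x n)) /\ equiv_ell1 x) :
  (forall f : L1 (lebesgue01 R) R^o,
     uniformly_integrable [set component T p.1 p.2 f | p in A `*` B] /\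
     @precompact (weak (L1 (lebesgue01 R) R^o))
       [set component T p.1 p.2 f | p in A `*` B]) /\
  (forall S : nat -> bop (L1 (lebesgue01 R) R^o) (L1 (lebesgue01 R) R^o),
     (forall n, [set component T p.1 p.2 | p in A `*` B] (S n)) ->
     exists k : nat -> nat, {homo k : m n / (m < n)%N} /\
       exists S0 : bop (L1 (lebesgue01 R) R^o) (L1 (lebesgue01 R) R^o),
         S (k n) @[n --> \oo]
           --> (S0 : wot (L1 (lebesgue01 R) R^o) (L1 (lebesgue01 R) R^o))).
Proof.
have fin := @lebesgue01_finite R.
have ui f := component_uniformly_integrable T hA hB f hl1.
have [C C0 HC] := component_bound T hA hB.
have small f : exists2 del, (forall e, 0 < e -> 0 < del e) &
    [set component T p.1 p.2 f | p in A `*` B]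
      `<=` small_integrals (C * `|f|) del.
  apply: uniformly_integrable_small (ui f) _.
  by move=> _ [[phi x] [/= Aphi Bx] <-]; exact: HC.
split=> [f|S SAB].
  split=> //; have [del del0 Hdel] := small f.
  exact: (small_integrals_precompact fin del0 Hdel).
apply: (wot_subsequence fin C0) => f; have [del del0 Hdel] := small f.
by exists del => // n; apply: Hdel; have [p pAB <-] := SAB n; exists p.
Qed.
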